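(* There is an absolute constant $c>0$ such that for every $n\ge 3$ and every $3$-uniform hypergraph $H$ on $n$ vertices with at least one hyperedge, $Q(f_{[H]}) \ge c\, n^{3/2}$.
   Context: For $3$-uniform hypergraphs $H$ and $G$, a homomorphism from $H$ to $G$ is a map $h:V(H)\to V(G)$ such that for every hyperedge $\{u,v,w\}\in E(H)$, the set $\{h(u),h(v),h(w)\}$ is a hyperedge of $G$ (in particular has three distinct elements). For a fixed $3$-uniform hypergraph $H$ on $n$ vertices, $f_{[H]}:\{0,1\}^{\binom n3}\to\{0,1\}$ takes as input a $3$-uniform hypergraph $G$ on $[n]$ given by its $\binom n3$ hyperedge-indicator bits, and $f_{[H]}(G)=1$ iff $H$ admits a homomorphism into $G$. $Q(f)$ denotes the bounded-error (success probability at least $2/3$) quantum query complexity of a Boolean function $f$. *)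

(* Defs.v *)
From HB Require Import structures.
From mathcomp Require Import all_boot all_order all_algebra.
Set Implicit Arguments. Unset Strict Implicit. Unset Printing Implicit Defensive.
Import Order.TTheory GRing.Theory Num.Theory.
Local Open Scope ring_scope.

Definition triple (n : nat) := {A : {set 'I_n} | #|A| == 3%N}.

Definition hypergraph (n : nat) := {set triple n}.

Definition is_hom (n : nat) (H G : hypergraph n) (h : 'I_n -> 'I_n) : bool :=
  [forall e in H, [exists g in G, val g == h @: val e]].

Definition f_hom (n : nat) (H : hypergraph n) (x : {ffun triple n -> bool}) : bool :=
  [exists h : {ffun 'I_n -> 'I_n}, is_hom H [set g | x g] h].

(** Amplitudes live in an arbitrary numClosedFieldType C (complex-like field
    with conjugation).  Input bits indexed by a finite type I.  The state space
    has basis 'I_(qdim I m) ~ (query register with #|I|+1 values, the extra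
    value being a null query) x (workspace of dimension m+1); basis index k has
    query-register value k %/ (m+1). *)
Definition qdim (I : finType) (m : nat) : nat := (#|I|.+1 * m.+1)%N.

Definition oracle (C : numClosedFieldType) (I : finType) (m : nat)
  (x : {ffun I -> bool}) : 'M[C]_(qdim I m) :=
  diag_mx (\row_k (if [pick i : I | nat_of_ord (enum_rank i) == (k %/ m.+1)%N]
                     is Some i then (if x i then -1 else 1) else 1)).

Definition unitary (C : numClosedFieldType) (d : nat) (U : 'M[C]_d) : bool :=
  U *m (map_mx Num.conj U)^T == 1%:M.

Fixpoint run (C : numClosedFieldType) (I : finType) (m : nat)
  (U : nat -> 'M[C]_(qdim I m)) (x : {ffun I -> bool}) (t : nat)
  : 'rV[C]_(qdim I m) :=
  match t with
  | 0 => (\row_k (if nat_of_ord k == 0%N then 1 else 0)) *m U 0%N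
  | t'.+1 => run U x t' *m oracle C m x *m U t
  end.

Definition prob_out (C : numClosedFieldType) (I : finType) (m : nat)
  (U : nat -> 'M[C]_(qdim I m)) (x : {ffun I -> bool}) (T : nat)
  (out : 'I_(qdim I m) -> bool) (b : bool) : C :=
  \sum_(k | out k == b) `|run U x T 0 k| ^+ 2.

(** There is a T-query quantum algorithm computing f with success
    probability >= 2/3 on every input.  Q(f) >= B iff every such T has T >= B. *)
Definition computes_bounded (C : numClosedFieldType) (I : finType)
  (f : {ffun I -> bool} -> bool) (T : nat) : Prop :=
  exists (m : nat) (U : nat -> 'M[C]_(qdim I m)) (out : 'I_(qdim I m) -> bool),
    (forall t, (t <= T)%N -> unitary (U t)) /\
    (forall x, 2%:R / 3%:R <= prob_out U x T out (f x)).

(* Main.v *)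
Require Import Defs.
From HB Require Import structures.
From mathcomp Require Import all_boot all_order all_algebra.
From mathcomp Require Import all_fingroup zify ring lra.
Set Implicit Arguments. Unset Strict Implicit. Unset Printing Implicit Defensive.
Import Order.TTheory GRing.Theory Num.Theory.
Local Open Scope ring_scope.

(** A bounded-error algorithm needs order sqrt d queries as soon as some
    restriction of the function to d free bits accepts an odd number of inputs:
    such a restriction disagrees in cardinality with the parity function, so by
    Huang's theorem the graph of its sensitive edges carries a vector fixed, up
    to the factor sqrt d, by a signed adjacency matrix of the hypercube, and this
    signed matrix serves as an adversary matrix.

    It remains to find, as in the theorem of Rivest and Vuillemin, a restriction
    of f_[H] to a box A x B x D of order n^3 hyperedges which is 0 on the
    empty box, 1 on the full box, and invariant under commuting involutions acting
    transitively on the box: only the full box is then a fixed accepted input, so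
    the number of accepted inputs is odd.  If H maps into the complete hypergraph
    on n - s vertices (s of order n), remove a critical edge from a minimal
    target and blow up its three vertices into the s spare ones.  If not, start
    from the hypergraph whose edges do not meet both A and B (it retracts onto
    n - s vertices), and add the edges of types ABd, AAB and ABB. *)

(** * Huang's signed hypercube matrix *)

Section Flip.
Variable J : finType.
Implicit Types (x y : {ffun J -> bool}) (u w : J).

Definition flip u x : {ffun J -> bool} := [ffun w => x w (+) (w == u)].

Lemma flipK u : involutive (flip u).
Proof. by move=> x; apply/ffunP=> w; rewrite !ffunE addbK. Qed.

Lemma flipC u w x : flip u (flip w x) = flip w (flip u x).
Proof. by apply/ffunP=> z; rewrite !ffunE addbAC. Qed.

Lemma flip_inj u : injective (flip u).
Proof. exact: inv_inj (flipK u). Qed.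

Definition parity x : bool := \big[addb/false]_w x w.

Lemma parity_flip u x : parity (flip u x) = ~~ parity x.
Proof.
rewrite /parity; under eq_bigr => w _ do rewrite ffunE.
rewrite big_split /= [X in _ (+) X](bigD1 u) //= eqxx.
by rewrite [X in true (+) X]big1 ?addbT // => w /negPf.
Qed.

(* Jordan-Wigner sign: it makes the coordinate flips anticommute. *)
Definition jw u x : bool :=
  \big[addb/false]_(w | (enum_rank w < enum_rank u)%N) x w.

Lemma jw_flip u w x :
  jw u (flip w x) = jw u x (+) (enum_rank w < enum_rank u)%N.
Proof.
rewrite /jw; under eq_bigr => z _ do rewrite ffunE.
rewrite big_split /=; congr addb; have [lt_wu|ge_wu] := boolP (_ < _)%N.
  rewrite (bigD1 w) //= eqxx.
  by rewrite [X in true (+) X]big1 // => z /andP[_ /negPf].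
by rewrite big1 // => z lt_zu; apply/eqP=> eq_zw; rewrite -eq_zw lt_zu in ge_wu.
Qed.

(** Half of all inputs have odd parity, so the two counts differ by twice the difference between the
    numbers of odd-parity and even-parity members of [S]; these numbers differ when [#|S|] is
    odd. *)
Lemma card_odd_neqC (S : {set {ffun J -> bool}}) (u0 : J) : odd #|S| ->
  #|[set x | (x \in S) == parity x]| != #|[set x | (x \in S) != parity x]|.
Proof.
set V := [set x | _ == _]; set W := [set x | _ != _] => oddS.
pose O := [set x | parity x].
have cO : #|O| = #|~: O|.
  rewrite -(card_imset _ (@flip_inj u0)); apply: eq_card => x.
  rewrite !inE; apply/imsetP/idP => [[y]|Nx].
    by rewrite inE => py ->; rewrite parity_flip py.
  by exists (flip u0 x); rewrite ?flipK // inE parity_flip.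
have cV : (#|V| + #|S :\: O| = #|S :&: O| + #|~: O|)%N.
  rewrite -(cardsID O V) -addnA; congr addn.
    by apply: eq_card => x; rewrite !inE; case: (x \in S); case: (parity x).
  rewrite -(cardsID S (~: O)) addnC; congr addn; apply: eq_card => x;
    by rewrite !inE; case: (x \in S); case: (parity x).
have cW : (#|W| + #|S :&: O| = #|S :\: O| + #|O|)%N.
  rewrite -(cardsID O W) addnAC addnC; congr addn.
    by apply: eq_card => x; rewrite !inE; case: (x \in S); case: (parity x).
  rewrite -(cardsID S O) addnC; congr addn; apply: eq_card => x;
    by rewrite !inE; case: (x \in S); case: (parity x).
move: oddS; rewrite -(cardsID O S) => oddS; apply/eqP=> eqVW.
have eqS : #|S :&: O| = #|S :\: O| by move: cV cW; rewrite -cO eqVW; clear; lia.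
by rewrite eqS addnn odd_double in oddS.
Qed.
End Flip.

Section Huang.
Variables (C : numClosedFieldType) (J : finType).
Local Notation T := {ffun J -> bool}.
Implicit Types (x y : T) (u w : J) (f g v : T -> C).

Definition sgn u x : C := (-1) ^+ jw u x.

Lemma sgn_flip u x : sgn u (flip u x) = sgn u x.
Proof. by rewrite /sgn jw_flip ltnn addbF. Qed.

Lemma sgn_anti u w x : u != w ->
  sgn u x * sgn w (flip u x) = - (sgn w x * sgn u (flip w x)).
Proof.
move=> neq_uw; rewrite /sgn !jw_flip.
have : enum_rank u != enum_rank w by rewrite (inj_eq enum_rank_inj).
rewrite -(inj_eq val_inj) /=; case: ltngtP => // _ _;
  by case: (jw u x); case: (jw w x); rewrite /= ?expr0 ?expr1; ring.
Qed.

Lemma sgnM u x : sgn u x * sgn u x = 1.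
Proof. by rewrite /sgn -signr_addb addbb. Qed.

Lemma sgn_conj u x : (sgn u x)^* = sgn u x.
Proof. by rewrite /sgn rmorph_sign. Qed.

(** Huang's signed adjacency matrix of the hypercube, as an operator on functions. *)
Definition hop f x : C := \sum_u sgn u x * f (flip u x).

(** Flipping one bit twice returns [f x] with sign 1; for two distinct bits the two orders of
    flipping cancel by [sgn_anti]. *)
Lemma hopK f x : hop (hop f) x = #|J|%:R * f x.
Proof.
rewrite /hop; under eq_bigr => u _ do rewrite mulr_sumr.
pose t u w := sgn u x * (sgn w (flip u x) * f (flip w (flip u x))).
rewrite -/(\sum_u \sum_w t u w).
have tt u : t u u = f x by rewrite /t sgn_flip flipK mulrA sgnM mul1r.
have tN u w : u != w -> t u w = - t w u.
  by move=> neq_uw; rewrite /t !mulrA sgn_anti // flipC mulNr.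
have -> : \sum_u \sum_w t u w = \sum_u t u u + \sum_u \sum_(w | w != u) t u w.
  by rewrite -big_split; apply: eq_bigr => u _; rewrite (bigD1 u).
rewrite (eq_bigr (fun=> f x)) // sumr_const mulr_natl.
set S := \sum_u \sum_(w | w != u) t u w.
have SN : S = - S.
  rewrite {1}/S (exchange_big_dep xpredT) //= -sumrN; apply: eq_bigr => u _.
  rewrite -sumrN; apply: eq_big => w; first by rewrite eq_sym.
  by move=> uw; rewrite (tN w u) // eq_sym.
suff -> : S = 0 by rewrite addr0.
by apply/eqP; rewrite -[_ == _](mulrn_eq0 S 2) mulr2n {1}SN addNr.
Qed.

Definition ip f g : C := \sum_x (f x)^* * g x.

(** The signs are real and agree at both ends of an edge, so the signed matrix is symmetric. *)
Lemma hop_self f g : ip f (hop g) = ip (hop f) g.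
Proof.
rewrite /ip /hop.
under eq_bigr => x _ do rewrite mulr_sumr.
under [RHS]eq_bigr => x _ do rewrite rmorph_sum mulr_suml.
rewrite exchange_big [RHS]exchange_big; apply: eq_bigr => u _ /=.
rewrite (reindex_inj (@flip_inj J u)); apply: eq_bigr => x _ /=.
by rewrite flipK sgn_flip [in RHS]rmorphM /= sgn_conj mulrCA mulrA.
Qed.

(* Huang's argument: the eigenspaces of [hop] for the two square roots of
   #|J| are exchanged by the parity sign, so each has half of the dimension. *)
Lemma hop_eigen (V : {set T}) (s : C) : s ^+ 2 = #|J|%:R ->
  (#|~: V| < #|V|)%N ->
  exists v, [/\ exists x, v x != 0, forall x, x \notin V -> v x = 0
              & forall x, hop v x = s * v x].
Proof.
move=> s2 ltV; set n := #|{: T}|.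
pose M : 'M[C]_n := \matrix_(i, j)
  \sum_(u | enum_val i == flip u (enum_val j)) sgn u (enum_val j).
have rowM (w : 'rV[C]_n) j :
    (w *m M) 0 j = hop (fun x => w 0 (enum_rank x)) (enum_val j).
  rewrite mxE /hop.
  under eq_bigr => i _ do rewrite mxE mulr_sumr.
  rewrite (exchange_big_dep xpredT) //=; apply: eq_bigr => u _.
  rewrite (big_pred1 (enum_rank (flip u (enum_val j)))) 1?mulrC // => i.
  by apply/eqP/eqP => [<-|->]; rewrite ?enum_valK ?enum_rankK.
have M2 : M *m M = (s ^+ 2)%:M.
  apply/matrixP=> i j; transitivity ((row i (M *m M)) 0 j); first by rewrite [RHS]mxE.
  rewrite row_mul rowE rowM.
  transitivity (hop (hop (fun x => (delta_mx 0 i : 'rV[C]_n) 0 (enum_rank x))) (enum_val j)).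
    by apply: eq_bigr => u _; rewrite rowM enum_rankK.
  by rewrite hopK s2 enum_valK !mxE eqxx /= mulr_natr eq_sym.
(* Every edge joins inputs of opposite parity, so conjugation by the parity sign negates [M] and
   fixes scalars. *)
pose P : 'M[C]_n := diag_mx (\row_i (-1) ^+ parity (enum_val i)).
have PMP : P *m (M + s%:M) *m P = - (M - s%:M).
  apply/matrixP=> i j; rewrite /P mul_mx_diag mul_diag_mx !mxE.
  set a := (-1) ^+ _; set b := (-1) ^+ _; set m := \sum_(u | _) _.
  have abm : a * m * b = - m.
    rewrite mulrAC /m mulr_sumr -sumrN; apply: eq_bigr => u /eqP eq_ij.
    by rewrite /a /b -signr_addb eq_ij parity_flip addNb addbb /= expr1 mulN1r.
  have abs : a * (s *+ (i == j)) * b = s *+ (i == j).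
    case: eqP => [eq_ij|_]; last by rewrite mulr0n mulr0 mul0r.
    by rewrite mulr1n mulrAC /a /b eq_ij -signr_addb addbb mul1r.
  by rewrite mulrDr mulrDl abm abs opprB addrC.
have rk : (\rank (M - s%:M)%R <= \rank (M + s%:M)%R)%N.
  rewrite -mxrank_opp -PMP; apply: leq_trans (mxrankM_maxl _ _) _.
  exact: mxrankM_maxr.
(* The product of [M - s] and [M + s] vanishes; with [rk] this bounds the rank of [M - s] by half of
   [n], hence below [#|V|]. *)
have rk0 : (\rank (M - s%:M)%R + \rank (M + s%:M)%R <= n)%N.
  apply: mulmx0_rank_max; rewrite mulmxBl !mulmxDr M2 -scalar_mxM -expr2 scalar_mxC.
  by rewrite [X in X - _]addrC subrr.
(* The rows of [E] are the indicators of the points of [V], so a combination of them killed by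
   [M - s] is an eigenvector supported on [V]. *)
pose E : 'M[C]_(#|V|, n) := \matrix_(k, j) (enum_val k == enum_val j)%:R.
have : kermx (E *m (M - s%:M)) != 0.
  rewrite kermx_eq0 -row_leq_rank -ltnNge.
  apply: leq_ltn_trans (mxrankM_maxr _ _) _.
  have : (#|V| + #|~: V|)%N = n by rewrite cardsC.
  move: ltV rk rk0; clear; lia.
case/rowV0Pn=> z /sub_kermxP zE0 /rV0Pn[k zk].
pose w := z *m E.
have wE j : w 0 j = \sum_k z 0 k * (enum_val k == enum_val j)%:R.
  by rewrite mxE; apply: eq_bigr => i _; rewrite mxE.
exists (fun x => w 0 (enum_rank x)); split.
- exists (enum_val k); rewrite wE enum_rankK (bigD1 k) //= eqxx mulr1 big1 ?addr0 //.
  by move=> i /negPf neq_ik; rewrite (inj_eq enum_val_inj) neq_ik mulr0.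
- move=> x xV; rewrite wE big1 // => i _; rewrite enum_rankK.
  by case: eqP => [eq_ix|]; [rewrite -eq_ix enum_valP in xV | rewrite mulr0].
move=> x; have := congr1 (fun w : 'rV_n => w 0 (enum_rank x)) zE0.
rewrite mulmxA mulmxBr mul_mx_scalar -/w mxE rowM.
by rewrite !mxE enum_rankK => /subr0_eq.
Qed.
End Huang.

(** * Adversary bound from odd cardinality *)

Section Run.
Variables (C : numClosedFieldType) (I : finType) (m : nat).
Local Notation d := (qdim I m).
Implicit Types (p q : 'rV[C]_d) (U : 'M[C]_d).

Definition dot p q : C := \sum_k (p 0 k)^* * q 0 k.

Lemma dotE p q : dot p q = (q *m (map_mx Num.conj p)^T) 0 0.
Proof. by rewrite mxE; apply: eq_bigr => k _; rewrite !mxE mulrC. Qed.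

Lemma dot_unitary U p q : unitary U -> dot (p *m U) (q *m U) = dot p q.
Proof.
move=> /eqP UU; rewrite !dotE map_mxM trmx_mul mulmxA -(mulmxA q).
by rewrite UU mulmx1.
Qed.

Definition query (k : 'I_d) : option I :=
  [pick i : I | nat_of_ord (enum_rank i) == (k %/ m.+1)%N].

Definition phase (x : {ffun I -> bool}) k : C :=
  if query k is Some i then (-1) ^+ x i else 1.

Lemma oracleE x p k : (p *m oracle C m x) 0 k = p 0 k * phase x k.
Proof.
rewrite mul_mx_diag !mxE /phase /query; case: pickP => // i _.
by case: (x i).
Qed.

Lemma phase_flip i x k :
  phase x k * phase (flip i x) k = if query k == Some i then -1 else 1.
Proof.
rewrite /phase; case: (query k) => [j|]; last by rewrite mulr1.
rewrite -signr_addb ffunE addKb.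
by have [->|/eqP neq_ji] := eqVneq j i; [rewrite eqxx | case: eqP => [[]|]].
Qed.

Lemma phaseM x k : phase x k * phase x k = 1.
Proof. by rewrite /phase; case: query => [j|]; rewrite ?mulr1 // -signr_addb addbb. Qed.

Lemma phase_conj x k : (phase x k)^* = phase x k.
Proof. by rewrite /phase; case: query => [j|]; rewrite ?rmorph_sign ?rmorph1. Qed.

Lemma run_norm (U : nat -> 'M[C]_d) x T : (forall t, (t <= T)%N -> unitary (U t)) ->
  forall t, (t <= T)%N -> dot (run U x t) (run U x t) = 1.
Proof.
move=> Uu; elim=> [|t IHt] le_tT /=; rewrite dot_unitary ?Uu //.
  have d_gt0 : (0 < d)%N by [].
  rewrite /dot (bigD1 (Ordinal d_gt0)) //= big1 => [|k neq_k0].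
    by rewrite !mxE /= conjC1 mulr1 addr0.
  by rewrite !mxE -[_ == 0%N]/(k == Ordinal d_gt0) (negPf neq_k0) mulr0.
rewrite -(IHt (ltnW le_tT)); apply: eq_bigr => k _.
by rewrite oracleE rmorphM /= phase_conj mulrACA phaseM mulr1.
Qed.
End Run.

(** * The adversary potential along a run *)

Section Adversary.
Variables (C : numClosedFieldType) (I J : finType) (m : nat).
Variables (iota : J -> I) (ext : {ffun J -> bool} -> {ffun I -> bool}).
Hypothesis iota_inj : injective iota.
Hypothesis ext_flip : forall u x, ext (flip u x) = flip (iota u) (ext x).
Variables (v : {ffun J -> bool} -> C).
Local Notation T := {ffun J -> bool}.
Local Notation d := (qdim I m).
Implicit Types (phi : T -> 'rV[C]_d).

(** The adversary potential: the Gram matrix of the states, weighted by the signed adjacency matrix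
    and by [v] at both ends of each edge. *)
Definition progress phi : C :=
  \sum_x \sum_u (v x)^* * (sgn C u x * v (flip u x)) * dot (phi x) (phi (flip u x)).

Definition column phi (k : 'I_d) (x : T) : C := v x * phi x 0 k.

(** Expanding the inner products by basis state reduces the estimates for a query and for the final
    states to quadratic forms of [hop]. *)
Lemma progressE phi :
  progress phi = \sum_k ip (column phi k) (hop (column phi k)).
Proof.
rewrite /progress /ip [RHS]exchange_big; apply: eq_bigr => x _ /=.
rewrite /hop; under [RHS]eq_bigr => k _ do rewrite mulr_sumr.
rewrite [RHS]exchange_big; apply: eq_bigr => u _ /=.
rewrite /dot mulr_sumr; apply: eq_bigr => k _.
by rewrite /column rmorphM /=; ring.
Qed.

Lemma column_norm phi : (forall x, dot (phi x) (phi x) = 1) ->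
  \sum_k ip (column phi k) (column phi k) = ip v v.
Proof.
move=> phi1; rewrite /ip exchange_big; apply: eq_bigr => x _ /=.
rewrite -[RHS]mulr1 -(phi1 x) mulr_sumr; apply: eq_bigr => k _.
by rewrite /column rmorphM /=; ring.
Qed.

(** Before the first query the state does not depend on the input; this gives the initial
    potential. *)
Lemma progress_const psi s : (forall x, hop v x = s * v x) ->
  dot psi psi = 1 -> progress (fun=> psi) = s * ip v v.
Proof.
move=> vs phi1; rewrite /progress /ip mulr_sumr; apply: eq_bigr => x _.
rewrite mulrCA -vs mulr_sumr; apply: eq_bigr => u _.
by rewrite phi1 mulr1.
Qed.

Lemma progress_unitary phi U : unitary U ->
  progress (fun x => phi x *m U) = progress phi.
Proof.
move=> Uu; apply: eq_bigr => x _; apply: eq_bigr => u _.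
by rewrite dot_unitary.
Qed.

Lemma ip_ge0 (f : T -> C) : 0 <= ip f f.
Proof. by apply: sumr_ge0 => x _; rewrite mulrC mul_conjC_ge0. Qed.

(** The signed flip in one direction is a self-adjoint involution, so its form is at most that of
    the identity: expand the squared norm of [f] minus its signed flip. *)
Lemma hop1_le (f : T -> C) u :
  \sum_x (f x)^* * (sgn C u x * f (flip u x)) <= ip f f.
Proof.
set Z := \sum_x _.
have ZE : Z = \sum_x (f (flip u x))^* * (sgn C u x * f x).
  rewrite /Z (reindex_inj (@flip_inj J u)); apply: eq_bigr => x _.
  by rewrite flipK sgn_flip.
have ipE : ip f f = \sum_x (f (flip u x))^* * f (flip u x).
  by rewrite /ip (reindex_inj (@flip_inj J u)).
rewrite -subr_ge0 -(pmulrn_lge0 _ (isT : 0 < 2)%N).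
have -> : (ip f f - Z) *+ 2 = \sum_x (f x - sgn C u x * f (flip u x))
   * (f x - sgn C u x * f (flip u x))^*.
  rewrite mulr2n {1}ZE {1}ipE /Z /ip -!sumrB -big_split; apply: eq_bigr => x _ /=.
  rewrite rmorphB rmorphM /= sgn_conj.
  have := sgnM C u x; set a := sgn C u x => aa.
  rewrite (_ : (_ - _) * _ = f x * (f x)^* - a * f (flip u x) * (f x)^*
     - a * (f (flip u x))^* * f x + (a * a) * (f (flip u x) * (f (flip u x))^*)); last by ring.
  by rewrite aa; ring.
by apply: sumr_ge0 => x _; rewrite mul_conjC_ge0.
Qed.

(** A basis state queries at most one bit, so by injectivity of [iota] at most one direction [u] is
    affected for each [k]. Its terms change sign, which costs twice the form bounded by
    [hop1_le]. *)
Lemma progress_oracle phi : (forall x, dot (phi x) (phi x) = 1) ->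
  progress phi - progress (fun x => phi x *m oracle C m (ext x)) <= 2 * ip v v.
Proof.
move=> phi1; rewrite -(column_norm phi1) mulr_sumr.
pose hit (k : 'I_d) u := query k == Some (iota u).
have -> : progress phi - progress (fun x => phi x *m oracle C m (ext x)) =
  \sum_k 2 * \sum_(u | hit k u) \sum_x
     (column phi k x)^* * (sgn C u x * column phi k (flip u x)).
  rewrite !progressE -sumrB; apply: eq_bigr => k _.
  rewrite exchange_big mulr_sumr /ip -sumrB; apply: eq_bigr => x _ /=.
  rewrite /hop !mulr_sumr -sumrB [RHS]big_mkcond; apply: eq_bigr => u _ /=.
  rewrite /column !oracleE ext_flip !rmorphM /= phase_conj.
  have := phase_flip C (iota u) (ext x) k; rewrite -/(hit k u).
  set p := phase C _ k; set q := phase C _ k => pq.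
  rewrite (_ : _ - _ = (1 - p * q) * ((v x)^* * (phi x 0 k)^* *
    (sgn C u x * (v (flip u x) * phi (flip u x) 0 k)))); last by ring.
  by rewrite pq; case: ifP => _; ring.
apply: ler_sum => k _; apply: ler_wpM2l => //.
have [u hit_u|no_hit] := pickP (hit k).
  rewrite (big_pred1 u) ?hop1_le // => w.
  move: hit_u; rewrite /hit => /eqP->; apply/eqP/eqP => [[/iota_inj]|->] //.
by rewrite big_pred0 // ip_ge0.
Qed.

(** On an edge inside the support of [v] the answer changes, so an output right at one end is wrong
    at the other: only products of a right part [R] and a wrong part [B] survive. As [B] carries at
    most a third of the weight, the potential falls below its initial value by a constant factor. *)
Lemma progress_final (g : T -> bool) (out : 'I_d -> bool) phi s :
  0 < s -> s ^+ 2 = #|J|%:R ->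
  (forall x u, v x != 0 -> v (flip u x) != 0 -> g (flip u x) != g x) ->
  (forall x, dot (phi x) (phi x) = 1) ->
  (forall x, 2%:R / 3%:R <= \sum_(k | out k == g x) `|phi x 0 k| ^+ 2) ->
  progress phi <= 17%:R / 18%:R * s * ip v v.
Proof.
move=> s_gt0 s2 sens phi1 right_prob.
pose R k x := if out k == g x then column phi k x else 0.
pose B k x := if out k == g x then 0 else column phi k x.
have XE k : ip (column phi k) (hop (column phi k)) =
    ip (R k) (hop (B k)) + ip (B k) (hop (R k)).
  rewrite /ip -big_split; apply: eq_bigr => x _ /=.
  rewrite /hop !mulr_sumr -big_split; apply: eq_bigr => u _ /=.
  rewrite /R /B /column.
  have [->|vx] := eqVneq (v x) 0.
    by rewrite !mul0r !if_same conjC0 !mul0r addr0.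
  have [->|vy] := eqVneq (v (flip u x)) 0.
    by rewrite !mul0r !if_same !mulr0 addr0.
  have := sens x u vx vy; case: (g x); case: (g _) => // _; case: (out k) => /=;
    by rewrite ?conjC0 ?mulr0 ?mul0r ?addr0 ?add0r.
have X_le k : ip (column phi k) (hop (column phi k)) <=
    s * (2%:R / 3%:R * ip (R k) (R k) + 3%:R / 2%:R * ip (B k) (B k)).
  rewrite XE -(ler_pM2l s_gt0).
  (* expand |a R - hop B|^2 >= 0; at error probability 1/3 the factor 2/3 is
     close to the optimal sqrt (1/2) *)
  pose a : C := 2%:R / 3%:R * s.
  have : 0 <= \sum_x (a * R k x - hop (B k) x) * (a * R k x - hop (B k) x)^*.
    by apply: sumr_ge0 => x _; rewrite mul_conjC_ge0.
  have -> : \sum_x (a * R k x - hop (B k) x) * (a * R k x - hop (B k) x)^* =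
      a ^+ 2 * ip (R k) (R k) - a * (ip (R k) (hop (B k)) + ip (hop (B k)) (R k))
      + ip (hop (B k)) (hop (B k)).
    rewrite /ip !(mulr_sumr, mulrDr) -!big_split /= -sumrB -big_split /=.
    apply: eq_bigr => x _; rewrite rmorphB rmorphM /=.
    have -> : a^* = a.
      by rewrite /a rmorphM /= (CrealP (ger0_real (ltW s_gt0))) fmorph_div !rmorph_nat.
    by ring.
  rewrite -[ip (hop (B k)) (R k)]hop_self.
  have -> : ip (hop (B k)) (hop (B k)) = s ^+ 2 * ip (B k) (B k).
    rewrite -hop_self /ip mulr_sumr; apply: eq_bigr => x _.
    by rewrite hopK -s2 mulrCA.
  set X := _ + ip (B k) _; set r := ip (R k) _; set b := ip (B k) _.
  move=> sq_ge0; rewrite -subr_ge0.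
  rewrite (_ : _ - _ = 3%:R / 2%:R * (a ^+ 2 * r - a * X + s ^+ 2 * b)); last first.
    by rewrite /a; field.
  by rewrite mulr_ge0 // divr_ge0 // ler0n.
have RB k : ip (column phi k) (column phi k) = ip (R k) (R k) + ip (B k) (B k).
  rewrite /ip -big_split; apply: eq_bigr => x _ /=.
  by rewrite /R /B; case: ifP => _; rewrite mulr0 ?addr0 ?add0r.
have R_ge : 2%:R / 3%:R * ip v v <= \sum_k ip (R k) (R k).
  rewrite /ip exchange_big mulr_sumr; apply: ler_sum => x _ /=.
  rewrite mulrC; apply: le_trans (ler_wpM2l _ (right_prob x)) _.
    by rewrite mulrC mul_conjC_ge0.
  rewrite mulr_sumr big_mkcond; apply: ler_sum => k _ /=.
  rewrite /R /column; case: ifP => _; last by rewrite mulr0.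
  by rewrite normCK rmorphM /= le_eqVlt; apply/orP; left; apply/eqP; ring.
have tot := column_norm phi1.
rewrite progressE; apply: le_trans (ler_sum _ (fun k _ => X_le k)) _.
rewrite -mulr_sumr big_split /= -!mulr_sumr.
move: tot; under eq_bigr => k _ do rewrite RB.
rewrite big_split /=; move: R_ge; set r := \sum_k _; set b := \sum_k _ => R_ge tot.
rewrite -(mulrA _ s) (mulrCA _ s) ler_pM2l // -tot.
rewrite -tot -subr_ge0 in R_ge; rewrite -subr_ge0.
(* At the extreme weights 2/3 and 1/3 the bound is 4/9 + 1/2 = 17/18. *)
rewrite (_ : _ - _ = 5%:R / 6%:R * (r - 2%:R / 3%:R * (r + b))); last by field.
by rewrite mulr_ge0 // divr_ge0 // ler0n.
Qed.
End Adversary.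

(** Some [V b], where [F] is the parity shifted by [b], holds more than half of the cube. Parity
    changes along every edge, so every edge inside [V b] is sensitive and the eigenvector of
    [hop_eigen] can serve as the weight [v]. *)
Lemma query_bound (C : numClosedFieldType) (I J : finType) (iota : J -> I)
    (ext : {ffun J -> bool} -> {ffun I -> bool}) (F : {ffun I -> bool} -> bool)
    (T : nat) :
  injective iota -> (forall u x, ext (flip u x) = flip (iota u) (ext x)) ->
  odd #|[set x | F (ext x)]| -> computes_bounded C F T ->
  (#|J| <= 1296 * T ^ 2)%N.
Proof.
move=> iota_inj ext_flip oddF [m [U [out [Uu right_prob]]]].
have [->//|J_gt0] := posnP #|J|; have /card_gt0P[u0 _] := J_gt0.
pose V b := [set x | F (ext x) == b (+) parity x].
have [b ltV] : exists b, (#|~: V b| < #|V b|)%N.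
  have VC b : ~: V b = V (~~ b).
    by apply/setP=> x; rewrite !inE; case: b; case: (F _); case: parity.
  have := card_odd_neqC u0 oddF.
  have -> : [set x | (x \in [set x | F (ext x)]) == parity x] = V false.
    by apply/setP=> x; rewrite !inE.
  have -> : [set x | (x \in [set x | F (ext x)]) != parity x] = V true.
    by apply/setP=> x; rewrite !inE; case: (F _); case: parity.
  by rewrite neq_ltn => /orP[]; [exists true | exists false]; rewrite VC.
pose s : C := sqrtC #|J|%:R.
have s2 : s ^+ 2 = #|J|%:R by rewrite sqrtCK.
have s_gt0 : 0 < s by rewrite sqrtC_gt0 ltr0n.
have [v [[x0 vx0] vV vs]] := hop_eigen s2 ltV.
have inV x : v x != 0 -> x \in V b by apply: contraNT => /vV->.
have nu_gt0 : 0 < ip v v.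
  rewrite /ip (bigD1 x0) //= ltr_wpDr //; last by rewrite mulrC mul_conjC_gt0.
  by apply: sumr_ge0 => x _; rewrite mulrC mul_conjC_ge0.
have sens x u : v x != 0 -> v (flip u x) != 0 -> F (ext (flip u x)) != F (ext x).
  by move=> /inV + /inV; rewrite !inE parity_flip => /eqP-> /eqP->; case: b {ltV vV inV};
    case: parity.
pose phi t x := run U (ext x) t.
have phi1 t : (t <= T)%N -> forall x, dot (phi t x) (phi t x) = 1.
  by move=> le_tT x; apply: run_norm Uu _ le_tT.
(* Unitaries preserve the potential, and each query lowers it by at most twice [ip v v]. *)
have low t : (t <= T)%N -> (s - 2 * t%:R) * ip v v <= progress v (phi t).
  elim: t => [|t IHt] le_tT.
    by rewrite mulr0 subr0 (progress_const vs (phi1 0 _ _)).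
  rewrite [progress _ _](_ : _ = progress v (fun x => phi t x *m oracle C m (ext x))); last first.
    exact: (progress_unitary _ (fun x => phi t x *m oracle C m (ext x)) (Uu _ le_tT)).
  have := progress_oracle iota_inj ext_flip v (phi1 _ (ltnW le_tT)).
  have := IHt (ltnW le_tT); set a := progress _ _; set c := progress _ _.
  rewrite -subr_ge0 => h1; rewrite -subr_ge0 => h2; rewrite -subr_ge0.
  by have := addr_ge0 h1 h2; congr (is_true (0 <= _)); rewrite -natr1; ring.
have := le_trans (low T (leqnn T))
  (progress_final s_gt0 s2 sens (phi1 T (leqnn T)) (fun x => right_prob (ext x))).
rewrite ler_pM2r // -subr_ge0 => le_sT.
(* What remains is [s / 18 <= 2 * T], hence [s <= 36 * T]; squaring gives 1296. *)
have {}le_sT : s <= 36%:R * T%:R.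
  rewrite -subr_ge0; have := mulr_ge0 (ler0n C 18) le_sT.
  by congr (is_true (0 <= _)); field.
have : s ^+ 2 <= (36%:R * T%:R) ^+ 2.
  by rewrite lerXn2r // nnegrE ?(ltW s_gt0) // mulr_ge0.
rewrite s2 -natrM -natrX ler_nat expnMn => /leq_trans; apply.
by rewrite leqnn.
Qed.

(** * Boxes of free hyperedges *)

Local Open Scope nat_scope.

(** The points moved by [t] pair up; [lo] picks the one of smaller rank from each pair. *)
Lemma odd_card_involution (X : finType) (S : {set X}) (t : X -> X) :
  involutive t -> {homo t : x / x \in S} ->
  odd #|S| = odd #|[set x in S | t x == x]|.
Proof.
move=> tK tS; rewrite -(cardsID [set x | t x == x] S) oddD.
have -> : S :&: [set x | t x == x] = [set x in S | t x == x].
  by apply/setP=> x; rewrite !inE.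
suff -> : odd #|S :\: [set x | t x == x]| = false by rewrite addbF.
pose lo := [set x in S | (enum_rank x < enum_rank (t x))%N].
rewrite (_ : _ :\: _ = lo :|: t @: lo); last first.
  apply/setP=> x; rewrite !inE.
  rewrite -(inj_eq enum_rank_inj) -(inj_eq val_inj) /=.
  have -> : (x \in t @: lo) = (x \in S) && (enum_rank (t x) < enum_rank x)%N.
    apply/imsetP/idP => [[y] | /andP[xS lt_x]].
      by rewrite inE => /andP[/tS yS lt_y] ->; rewrite tK yS.
    by exists (t x); rewrite ?tK // inE tK (tS _ xS).
  by rewrite neq_ltn; case: (x \in S); rewrite ?andbF ?andbT // orbC.
rewrite cardsU card_imset; last exact: inv_inj tK.
rewrite (_ : _ :&: _ = set0) ?cards0 ?subn0 ?addnn ?odd_double //.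
apply/setP=> x; rewrite !inE; apply/negbTE/negP => /andP[/andP[_ lt_x]].
case/imsetP=> y; rewrite inE => /andP[_ lt_y] eq_x; move: lt_x.
by rewrite eq_x tK ltnNge ltnW.
Qed.

(** Commutation keeps the fixed points of one involution stable under the others, so the involutions
    can be used one after another. *)
Lemma odd_card_involutions (K : eqType) (X : finType) (S : {set X})
    (t : K -> X -> X) (s : seq K) :
  {in s, forall k, involutive (t k)} ->
  {in s &, forall k l x, t k (t l x) = t l (t k x)} ->
  {in s, forall k, {homo t k : x / x \in S}} ->
  odd #|S| = odd #|[set x in S | all (fun k => t k x == x) s]|.
Proof.
elim: s S => [|k s IHs] S tK tC tS.
  by congr (odd _); apply: eq_card => x; rewrite !inE andbT.
have ks : k \in k :: s by exact: mem_head.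
have sub l : l \in s -> l \in k :: s by move=> ls; rewrite inE ls orbT.
rewrite (odd_card_involution (tK k ks) (tS k ks)) IHs.
- by congr (odd _); apply: eq_card => x; rewrite !inE /= andbA.
- by move=> l /sub; apply: tK.
- by move=> l1 l2 /sub ? /sub; apply: tC.
move=> l /sub ls x; rewrite !inE => /andP[xS /eqP kx].
by rewrite (tS _ ls _ xS) /= tC // kx.
Qed.

(** * Homomorphisms and vertex permutations *)

Section Homomorphism.
Variables (n : nat) (H : hypergraph n).
Local Notation V := 'I_n.
Implicit Types (e : {set V}) (P Q : {set V} -> bool) (tau : {perm V}).

Lemma f_hom_map (psi : V -> V) (x y : {ffun triple n -> bool}) :
  (forall g, x g -> exists2 g', y g' & val g' = psi @: val g) ->
  f_hom H x -> f_hom H y.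
Proof.
move=> xy /existsP[h /forall_inP hH].
apply/existsP; exists [ffun i => psi (h i)]; apply/forall_inP=> e /hH.
case/existsP=> g; rewrite inE => /andP[/xy[g' yg' eg'] /eqP eg].
apply/existsP; exists g'; rewrite inE yg' /= eg' eg -imset_comp.
by apply/eqP/eq_imset => i; rewrite /= ffunE.
Qed.

(** A target hypergraph is given by a predicate on all vertex sets, of which only the values on
    triples count. *)
Definition hom_into P := f_hom H [ffun g => P (val g)].

Lemma hom_into_map (psi : V -> V) P Q :
  (forall e, #|e| = 3 -> P e -> #|psi @: e| = 3 /\ Q (psi @: e)) ->
  hom_into P -> hom_into Q.
Proof.
move=> PQ; apply: (@f_hom_map psi) => g; rewrite ffunE => Pg.
have [/eqP card3 Qg] := PQ _ (eqP (valP g)) Pg.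
by exists (Sub (psi @: val g) card3 : triple n); rewrite ?ffunE SubK.
Qed.

Lemma hom_into_sub P Q :
  (forall e, #|e| = 3 -> P e -> Q e) -> hom_into P -> hom_into Q.
Proof.
move=> PQ; apply: (@hom_into_map id) => e e3 Pe.
by rewrite imset_id; split=> //; apply: PQ.
Qed.

(** The default of [insubd] never occurs, since permutations preserve cardinality. *)
Definition permt tau (g : triple n) : triple n := insubd g (tau @: val g).

Lemma val_permt tau g : val (permt tau g) = tau @: val g.
Proof. by rewrite val_insubd card_imset ?(valP g) //; apply: perm_inj. Qed.

Definition tact tau (y : {ffun triple n -> bool}) : {ffun triple n -> bool} :=
  [ffun g => y (permt tau g)].

Lemma tactK tau : involutive tau -> involutive (tact tau).
Proof.
move=> tauK y; apply/ffunP=> g; rewrite !ffunE; congr (y _); apply/val_inj.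
by rewrite !val_permt -imset_comp -[RHS]imset_id; apply: eq_imset.
Qed.

Lemma tactC tau1 tau2 y : (forall v, tau1 (tau2 v) = tau2 (tau1 v)) ->
  tact tau1 (tact tau2 y) = tact tau2 (tact tau1 y).
Proof.
move=> tauC; apply/ffunP=> g; rewrite !ffunE; congr (y _); apply/val_inj.
by rewrite !val_permt -!imset_comp; apply: eq_imset => v /=.
Qed.

Lemma f_hom_tact tau y : involutive tau -> f_hom H y -> f_hom H (tact tau y).
Proof.
move=> tauK; apply: (@f_hom_map tau) => g yg.
exists (permt tau g); last exact: val_permt.
by rewrite -[y](tactK tauK) ffunE in yg.
Qed.

(** The last clause is transitivity on [A] of the group generated by [s], stated without words in
    the generators: a stable set that meets [A] contains it. *)
Definition toggles (A : {set V}) (s : seq {perm V}) :=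
  [/\ {in s, forall tau, perm_on A tau},
      {in s, forall tau : {perm V}, involutive tau},
      {in s &, forall tau1 tau2 v, tau1 (tau2 v) = tau2 (tau1 v)}
    & forall X : {set V}, {in s, forall tau : {perm V}, {homo tau : v / v \in X}} ->
        forall a b, a \in A -> b \in A -> a \in X -> b \in X].

Definition box (A B D : {set V}) e :=
  [&& #|e :&: A| == 1, #|e :&: B| == 1 & #|e :&: D| == 1]%N.

Lemma card_stableI (A : {set V}) tau e :
  (forall v, (tau v \in A) = (v \in A)) -> #|(tau @: e) :&: A| = #|e :&: A|.
Proof.
move=> tauA; rewrite -(card_imset (e :&: A) (@perm_inj _ tau)); apply: eq_card => v.
rewrite inE; apply/andP/imsetP => [[/imsetP[w we ->] tA]|[w]].
  by exists w; rewrite // inE we -tauA.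
by rewrite inE => /andP[we wA] ->; rewrite imset_f // tauA.
Qed.

Lemma perm_on_stable (A B : {set V}) tau : perm_on A tau -> A = B \/ [disjoint A & B] ->
  forall v, (tau v \in B) = (v \in B).
Proof.
move=> tauA [<-|disAB] v; first by rewrite perm_closed.
have [vA|vA] := boolP (v \in A); last by rewrite (out_perm tauA).
by rewrite !(disjointFr disAB) // perm_closed.
Qed.

Lemma boxP (A B D : {set V}) e :
  [disjoint A & B] -> [disjoint A & D] -> [disjoint B & D] -> #|e| = 3 ->
  reflect (exists a b d, [/\ a \in A, b \in B, d \in D & e = [set a; b; d]])
          (box A B D e).
Proof.
move=> dAB dAD dBD e3; apply: (iffP and3P) => [[/cards1P[a ea] /cards1P[b eb] /cards1P[d ed]]|].
  have /setIP[ae aA] : a \in e :&: A by rewrite ea set11.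
  have /setIP[be bB] : b \in e :&: B by rewrite eb set11.
  have /setIP[de dD] : d \in e :&: D by rewrite ed set11.
  exists a, b, d; split=> //; apply/esym/eqP; rewrite eqEcard e3; apply/andP; split.
    by apply/subsetP=> v; rewrite !inE => /orP[/orP[]|] /eqP->.
  have ab : a != b by apply: contraTneq bB => <-; rewrite (disjointFr dAB).
  have ad : a != d by apply: contraTneq dD => <-; rewrite (disjointFr dAD).
  have bd : b != d by apply: contraTneq dD => <-; rewrite (disjointFr dBD).
  by rewrite setUC cardsU1 cards2 ab !inE (eq_sym d a) (eq_sym d b) (negPf ad) (negPf bd).
case=> a [b [d [aA bB dD ->]]].
have I1 (X : {set V}) v : v \in X -> {in [set a; b; d], forall w, w \in X -> w = v} ->
    v \in [set a; b; d] -> #|[set a; b; d] :&: X| == 1%N.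
  move=> vX only ve; apply/cards1P; exists v; apply/setP=> w; rewrite in_setI in_set1.
  by apply/andP/eqP => [[? ?]|->//]; apply: only.
split; [apply: (I1 _ a)|apply: (I1 _ b)|apply: (I1 _ d)] => //;
  try (by rewrite !inE eqxx ?orbT); move=> w; rewrite !inE => /orP[/orP[]|] /eqP-> //.
- by rewrite (disjointFl dAB).
- by rewrite (disjointFl dAD).
- by rewrite (disjointFr dAB).
- by rewrite (disjointFl dBD).
- by rewrite (disjointFr dAD).
- by rewrite (disjointFr dBD).
Qed.

End Homomorphism.

(** * Parity of the accepted inputs over a box *)

Section BoxBound.
Variables (n : nat) (H : hypergraph n).
Local Notation V := 'I_n.
Implicit Types (e : {set V}) (tau : {perm V}).
Variables (A B D : {set V}) (sA sB sD : seq {perm V}) (P : {set V} -> bool).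
Hypotheses (dAB : [disjoint A & B]) (dAD : [disjoint A & D]) (dBD : [disjoint B & D]).
Hypotheses (tA : toggles A sA) (tB : toggles B sB) (tD : toggles D sD).
Hypothesis P_stable : forall tau e, tau \in sA ++ sB ++ sD -> #|e| = 3 ->
  ~~ box A B D e -> P (tau @: e) = P e.

Let s := sA ++ sB ++ sD.

Lemma toggle_cases tau : tau \in s ->
  [\/ tau \in sA /\ perm_on A tau, tau \in sB /\ perm_on B tau
    | tau \in sD /\ perm_on D tau].
Proof.
case: tA tB tD => [onA _ _ _] [onB _ _ _] [onD _ _ _]; rewrite !mem_cat.
by case/or3P => ts; [apply: Or31 | apply: Or32 | apply: Or33]; split=> //;
  [apply: onA | apply: onB | apply: onD].
Qed.

Lemma toggle_invol tau : tau \in s -> involutive tau.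
Proof.
case: tA tB tD => [_ KA _ _] [_ KB _ _] [_ KD _ _]; rewrite !mem_cat.
by case/or3P => ?; [apply: KA | apply: KB | apply: KD].
Qed.

Lemma toggle_comm tau1 tau2 v : tau1 \in s -> tau2 \in s ->
  tau1 (tau2 v) = tau2 (tau1 v).
Proof.
have perm_comm (X Y : {set V}) (t1 t2 : {perm V}) :
    [disjoint X & Y] -> perm_on X t1 -> perm_on Y t2 -> t1 (t2 v) = t2 (t1 v).
  move=> dXY on1 on2; have := perm_onC on1 on2 dXY.
  by move/permP/(_ v); rewrite !permM.
case: tA tB tD => [_ _ CA _] [_ _ CB _] [_ _ CD _].
move=> /toggle_cases[] [in1 on1] /toggle_cases[] [in2 on2].
- exact: CA.
- exact: perm_comm dAB on1 on2.
- exact: perm_comm dAD on1 on2.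
- by apply/esym/(perm_comm A B).
- exact: CB.
- exact: perm_comm dBD on1 on2.
- by apply/esym/(perm_comm A D).
- by apply/esym/(perm_comm B D).
- exact: CD.
Qed.

Lemma toggle_box tau e : tau \in s -> box A B D (tau @: e) = box A B D e.
Proof.
have dBA : [disjoint B & A] by rewrite disjoint_sym.
have dDA : [disjoint D & A] by rewrite disjoint_sym.
have dDB : [disjoint D & B] by rewrite disjoint_sym.
case/toggle_cases=> [] [_ on]; rewrite /box !card_stableI //;
  by apply: (perm_on_stable on); auto.
Qed.

Let free := [pred g : triple n | box A B D (val g)].
Let J := {g : triple n | free g}.
Let ext (x : {ffun J -> bool}) : {ffun triple n -> bool} :=
  [ffun g => if insub g is Some u then x u else P (val g)].

Lemma ext_flip u x : ext (flip u x) = flip (val u) (ext x).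
Proof.
apply/ffunP=> g; rewrite !ffunE; case: insubP => [w _ eg|Ng].
  by rewrite ffunE -eg (inj_eq val_inj).
rewrite (_ : (g == _) = false) ?addbF //; apply/negbTE.
by apply: contraNneq Ng => ->; exact: (valP u).
Qed.

Lemma card_free : (#|A| * #|B| * #|D| <= #|{: J}|)%N.
Proof.
rewrite card_sig.
have -> : #|free| = #|[set e : {set V} | (#|e| == 3) && box A B D e]|.
  rewrite -(card_imset _ val_inj); apply: eq_card => e; rewrite inE.
  apply/imsetP/andP => [[g bg ->]|[e3 be]]; first by rewrite (valP g).
  by exists (Sub e e3 : triple n).
rewrite -!cardsX.
pose f (p : V * V * V) := [set p.1.1; p.1.2; p.2].
rewrite -(@card_in_imset _ _ f).
  apply/subset_leq_card/subsetP=> e /imsetP[[[a b] d]].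
  rewrite !inE /= => /andP[/andP[aA bB] dD] ->.
  have ab : a != b by apply: contraTneq bB => <-; rewrite (disjointFr dAB).
  have ad : a != d by apply: contraTneq dD => <-; rewrite (disjointFr dAD).
  have bd : b != d by apply: contraTneq dD => <-; rewrite (disjointFr dBD).
  have e3 : #|f (a, b, d)| = 3.
    by rewrite /f setUC cardsU1 cards2 ab !inE (eq_sym d a) (eq_sym d b) (negPf ad) (negPf bd).
  by rewrite e3 eqxx; apply/boxP => //; exists a, b, d.
move=> [[a b] d] [[a' b'] d']; rewrite !inE /= => /andP[/andP[aA bB] dD].
move=> /andP[/andP[aA' bB'] dD'] /setP eq_e.
have := eq_e a; rewrite !inE eqxx /= => /esym/orP[/orP[]|] /eqP eqa;
  [rewrite eqa | by rewrite eqa (disjointFl dAB) in aA | by rewrite eqa (disjointFl dAD) in aA].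
have := eq_e b; rewrite !inE eqxx orbT /= => /esym/orP[/orP[]|] /eqP eqb;
  [by rewrite eqb (disjointFr dAB) in bB | rewrite eqb | by rewrite eqb (disjointFl dBD) in bB].
have := eq_e d; rewrite !inE eqxx orbT /= => /esym/orP[/orP[]|] /eqP eqd;
  [by rewrite eqd (disjointFr dAD) in dD | by rewrite eqd (disjointFr dBD) in dD | by rewrite eqd].
Qed.

Let full e := P e || box A B D e.
Hypothesis full1 : hom_into H full.
Hypothesis empty0 : ~~ hom_into H (fun e => P e && ~~ box A B D e).

(** Working with full inputs instead of assignments to [J] lets the vertex permutations act
    directly. *)
Let S := [set y | f_hom H y && [forall g, ~~ free g ==> (y g == P (val g))]].

Lemma card_S : #|[set x | f_hom H (ext x)]| = #|S|.
Proof.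
have ext_inj : injective ext.
  by move=> x y /ffunP exy; apply/ffunP=> u; have := exy (val u); rewrite !ffunE valK.
rewrite -(card_imset _ ext_inj); apply: eq_card => y; rewrite inE.
apply/imsetP/andP => [[x]|[Hy /forallP yP]].
  rewrite inE => Hx ->; split=> //; apply/forallP=> g; apply/implyP=> Ng.
  by rewrite ffunE insubN.
have ey : y = ext [ffun u => y (val u)].
  apply/ffunP=> g; rewrite ffunE; case: insubP => [u _ <-|Ng]; first by rewrite ffunE.
  by have /implyP/(_ Ng)/eqP := yP g.
by exists [ffun u => y (val u)]; rewrite // inE -ey.
Qed.

Lemma S_stable tau : tau \in s -> {homo tact tau : y / y \in S}.
Proof.
move=> ts y; rewrite !inE => /andP[Hy /forallP yP].
rewrite f_hom_tact //=; last exact: toggle_invol.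
apply/forallP=> g; apply/implyP=> Ng; rewrite ffunE.
have fg : free (permt tau g) = free g by rewrite /= val_permt toggle_box.
have /implyP := yP (permt tau g); rewrite fg => /(_ Ng)/eqP->.
by rewrite val_permt P_stable // (eqP (valP g)).
Qed.

(** A toggle of one part moves at most one vertex of a box edge, so transitivity replaces the three
    vertices one at a time. [Y] extends [y] by false to sets that are not triples. *)
Lemma fixed_const y a b d a' b' d' : {in s, forall tau, tact tau y = y} ->
  let Y e := if insub e is Some g then y g else false in
  a \in A -> b \in B -> d \in D -> a' \in A -> b' \in B -> d' \in D ->
  Y [set a; b; d] -> Y [set a'; b'; d'].
Proof.
move=> fixy Y aA bB dD aA' bB' dD'.
have Ytau tau e : tau \in s -> Y (tau @: e) = Y e.
  move=> ts; rewrite /Y; case: insubP => [g _ eg|Ne].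
    have e3 : #|e| == 3 by rewrite -(card_imset e (@perm_inj _ tau)) -eg (valP g).
    rewrite (insubT (fun e : {set V} => #|e| == 3) e3) -[in RHS](fixy _ ts) ffunE; congr (y _).
    by apply/val_inj; rewrite val_permt.
  by rewrite insubN // -(card_imset e (@perm_inj _ tau)).
have im3 tau u v w : tau @: [set u; v; w] = [set tau u; tau v; tau w].
  by rewrite !imsetU !imset_set1.
case: tA tB tD => [onA _ _ trA] [onB _ _ trB] [onD _ _ trD] Y0.
have Y1 : a' \in [set x | Y [set x; b; d]].
  apply: trA aA aA' _; rewrite ?inE // => tau ts x; rewrite !inE => Yx.
  have := Ytau tau [set x; b; d]; rewrite im3 mem_cat ts => /(_ isT).
  by rewrite (out_perm (onA _ ts) (_ : b \notin A)) ?(disjointFl dAB) //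
    (out_perm (onA _ ts) (_ : d \notin A)) ?(disjointFl dAD) // => ->.
rewrite inE in Y1.
have Y2 : b' \in [set x | Y [set a'; x; d]].
  apply: trB bB bB' _; rewrite ?inE // => tau ts x; rewrite !inE => Yx.
  have := Ytau tau [set a'; x; d]; rewrite im3 !mem_cat ts orbT => /(_ isT).
  by rewrite (out_perm (onB _ ts) (_ : a' \notin B)) ?(disjointFr dAB) //
    (out_perm (onB _ ts) (_ : d \notin B)) ?(disjointFl dBD) // => ->.
rewrite inE in Y2.
have : d' \in [set x | Y [set a'; b'; x]].
  apply: trD dD dD' _; rewrite ?inE // => tau ts x; rewrite !inE => Yx.
  have := Ytau tau [set a'; b'; x]; rewrite im3 !mem_cat ts !orbT => /(_ isT).
  by rewrite (out_perm (onD _ ts) (_ : a' \notin D)) ?(disjointFr dAD) //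
    (out_perm (onD _ ts) (_ : b' \notin D)) ?(disjointFr dBD) // => ->.
by rewrite inE.
Qed.

(** Only inputs fixed by all toggles affect the parity. They are constant on the box, and [empty0]
    rejects the empty box, so the full one alone remains. *)
Lemma odd_S : odd #|S|.
Proof.
rewrite (@odd_card_involutions _ _ S (@tact n) s).
- rewrite (_ : [set _ in _ | _] = [set [ffun g => full (val g)]]) ?cards1 //.
  apply/setP=> y; rewrite in_set1 in_set.
  apply/andP/eqP => [[]|->]; last first.
    split.
      rewrite inE; apply/andP; split; first exact: full1.
      by apply/forallP=> g; apply/implyP=> /negPf Ng; rewrite ffunE /full [box _ _ _ _]Ng orbF.
    apply/allP=> tau ts; apply/eqP/ffunP=> g; rewrite !ffunE val_permt /full toggle_box //.
    have [bg|Nb] := boolP (box A B D (val g)); first by rewrite !orbT.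
    by rewrite P_stable // (eqP (valP g)).
  rewrite inE => /andP[Hy /forallP yP] /allP fixy.
  have {}fixy : {in s, forall tau, tact tau y = y} by move=> tau /fixy/eqP.
  have yN g : ~~ box A B D (val g) -> y g = P (val g).
    by move=> Ng; have /implyP/(_ Ng)/eqP := yP g.
  have [g0 /andP[bg0 yg0]|none] := pickP (fun g => box A B D (val g) && y g).
    apply/ffunP=> g; rewrite ffunE /full.
    have [bg|/yN->] := boolP (box _ _ _ _); last by rewrite orbF.
    have /(boxP dAB dAD dBD (eqP (valP g0)))[a [b [d [aA bB dD eg0]]]] := bg0.
    have /(boxP dAB dAD dBD (eqP (valP g)))[a' [b' [d' [aA' bB' dD' eg]]]] := bg.
    have := fixed_const fixy aA bB dD aA' bB' dD'.
    by rewrite -eg0 -eg !valK orbT => /(_ yg0).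
  case/negP: empty0; rewrite /hom_into (_ : [ffun _ => _] = y) //.
  apply/ffunP=> g; rewrite ffunE; have [bg|/yN->] := boolP (box _ _ _ _); last by rewrite andbT.
  by have := none g; rewrite bg andbF /= => ->.
- by move=> tau ts; apply/tactK/toggle_invol.
- by move=> tau1 tau2 ts1 ts2 y; apply: tactC => v; apply: toggle_comm.
exact: S_stable.
Qed.

Lemma box_bound (C : numClosedFieldType) (T : nat) :
  computes_bounded C (@f_hom n H) T -> (#|A| * #|B| * #|D| <= 1296 * T ^ 2)%N.
Proof.
move=> comp; apply: leq_trans card_free _.
apply: (query_bound (@val_inj _ _ J) ext_flip _ comp).
by rewrite card_S odd_S.
Qed.

End BoxBound.

(** * Cube labellings and their toggles *)

Section Cube.
Variables (n j : nat).
Local Notation V := 'I_n.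
Local Notation cube := {ffun 'I_j -> bool}.
Variable alpha : cube -> V.
Hypothesis alpha_inj : injective alpha.

Lemma flip_neq u w (i k : 'I_j) : (flip i u k != w k) = (u k != w k) (+) (k == i).
Proof. by rewrite ffunE; move: (u k) (w k) (k == i) => [] [] []. Qed.

Lemma cube_flip (Q : pred cube) (i : 'I_j) : (forall u, Q (flip i u) = Q u) ->
  exists tau : {perm V}, perm_on [set alpha u | u in Q] tau /\
    forall u, tau (alpha u) = if Q u then alpha (flip i u) else alpha u.
Proof.
move=> Qi.
pose f v := if [pick u | (alpha u == v) && Q u] is Some u then alpha (flip i u) else v.
have fE u : f (alpha u) = if Q u then alpha (flip i u) else alpha u.
  rewrite /f; case: pickP => [w /andP[/eqP/alpha_inj-> ->//]|none].
  by have := none u; rewrite eqxx /= => ->.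
have fN v : v \notin [set alpha u | u in Q] -> f v = v.
  move=> vN; rewrite /f; case: pickP => // u /andP[/eqP uv Qu].
  by case/imsetP: vN; exists u.
have fK : involutive f.
  move=> v; have [/imsetP[u Qu ->]|vN] := boolP (v \in [set alpha u | u in Q]).
    by rewrite -topredE /= in Qu; rewrite !fE Qu fE Qi Qu flipK.
  by rewrite !fN.
exists (perm (inv_inj fK)); split; last by move=> u; rewrite permE.
by apply/subsetP=> v; rewrite inE permE; apply: contraR => /fN->.
Qed.

(** [Q] is a face of the cube with free directions [K], and each toggle flips one free coordinate.
    Two points of the face differ only in free directions, so flipping these one by one gives
    transitivity. *)
Lemma cube_toggles (Q K : pred _) :
  (forall i u, K i -> Q (flip i u) = Q u) ->
  (forall u w, Q u -> Q w -> forall i, ~~ K i -> u i = w i) ->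
  exists s, toggles [set alpha u | u in Q] s /\
    {in s, forall tau : {perm V}, exists2 i, K i &
       forall u, tau (alpha u) = if Q u then alpha (flip i u) else alpha u}.
Proof.
move=> QK Qeq; pose A := [set alpha u | u in Q].
pose good i (tau : {perm V}) := perm_on A tau &&
  [forall u, tau (alpha u) == if Q u then alpha (flip i u) else alpha u].
pose f i := odflt 1%g [pick tau | good i tau].
have fP i : K i -> good i (f i).
  move=> Ki; rewrite /f; case: pickP => //= none.
  have [tau [onA tauE]] := cube_flip (fun u => QK i u Ki).
  by have /andP[] := none tau; split=> //; apply/forallP=> u; rewrite tauE.
have fA i : K i -> perm_on A (f i) by move=> /fP/andP[].
have fE i u : K i -> f i (alpha u) = if Q u then alpha (flip i u) else alpha u.
  by move=> /fP/andP[_ /forallP/(_ u)/eqP].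
exists [seq f i | i <- enum K].
have inS tau : tau \in [seq f i | i <- enum K] -> exists2 i, K i & tau = f i.
  by case/mapP=> i; rewrite mem_enum => Ki ->; exists i.
have caseA v : (exists2 u, Q u & v = alpha u) \/ v \notin A.
  have [/imsetP[u Qu ->]|] := boolP (v \in A); first by left; exists u.
  by right.
split; last by move=> tau /inS[i Ki ->]; exists i => // u; apply: fE.
split.
- by move=> tau /inS[i Ki ->]; apply: fA.
- move=> tau /inS[i Ki ->] v; have [[u Qu ->]|vN] := caseA v.
    by rewrite fE // Qu fE // QK // Qu flipK.
  by rewrite !(out_perm (fA i Ki) vN).
- move=> tau1 tau2 /inS[i Ki ->] /inS[k Kk ->] v; have [[u Qu ->]|vN] := caseA v.
    by rewrite !fE // Qu !fE // !QK // Qu flipC.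
  by rewrite !((out_perm (fA i Ki) vN), (out_perm (fA k Kk) vN)).
move=> X Xs a b /imsetP[u Qu ->] /imsetP[w Qw ->].
have [m] := ubnP #|[set i | u i != w i]|.
elim: m u Qu => // m IHm u Qu; rewrite ltnS => le_m Xu.
have [i neq_i|eq_uw] := pickP (fun i => u i != w i); last first.
  by rewrite (_ : w = u) //; apply/ffunP=> i; apply/esym/eqP/negPn; rewrite eq_uw.
have Ki : K i by apply: contraT => NKi; rewrite (Qeq u w) ?eqxx in neq_i.
apply: (IHm (flip i u)).
- by rewrite -topredE /= QK.
- apply: leq_trans le_m; apply/proper_card/properP; split.
    apply/subsetP=> k; rewrite !inE flip_neq.
    by have [->|] := eqVneq k i; rewrite ?addbF ?neq_i.
  by exists i; rewrite !inE ?flip_neq ?eqxx neq_i.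
have := Xs (f i) _ (alpha u) Xu; rewrite fE // [Q u]Qu; apply.
by apply: map_f; rewrite mem_enum.
Qed.

End Cube.

Section CubeSets.
Variables (n j : nat).
Local Notation V := 'I_n.
Local Notation cube := {ffun 'I_j -> bool}.

Lemma cube_of_set (A : {set V}) : #|A| = 2 ^ j ->
  exists2 alpha : cube -> V, injective alpha & A = [set alpha u | u : cube].
Proof.
move=> cA; have cE : #|{: cube}| = #|A| by rewrite card_ffun card_bool card_ord.
exists (fun u => enum_val (cast_ord cE (enum_rank u))).
  by move=> u w /enum_val_inj/cast_ord_inj/enum_rank_inj.
apply/setP=> v; apply/idP/imsetP => [vA|[u _ ->]]; last exact: enum_valP.
exists (enum_val (cast_ord (esym cE) (enum_rank_in vA v))) => //.
by rewrite enum_valK cast_ordKV enum_rankK_in.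
Qed.

Lemma set_toggles (A : {set V}) : #|A| = 2 ^ j -> exists s, toggles A s.
Proof.
case/cube_of_set=> alpha alpha_inj ->.
by have [//|//|s [tA _]] := cube_toggles alpha_inj (Q := xpredT) (K := xpredT); exists s.
Qed.

End CubeSets.

(** * Critical boxes for hypergraph homomorphism *)

Section PairStep.
Variables (n : nat) (H : hypergraph n) (A B : {set 'I_n}) (j : nat).
Local Notation V := 'I_n.
Local Notation cube := {ffun 'I_j -> bool}.
Implicit Types (e : {set V}) (tau : {perm V}).
Variables (sB : seq {perm V}) (M : {set V} -> bool).
Hypotheses (dAB : [disjoint A & B]) (cA : #|A| = 2 ^ j) (tB : toggles B sB).
Hypothesis M_stable : forall tau e, perm_on A tau \/ perm_on B tau ->
  M (tau @: e) = M e.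

Let aab e := (#|e :&: A| == 2) && (#|e :&: B| == 1).

Lemma pair_step (C : numClosedFieldType) (T : nat) :
  ~~ hom_into H (fun e => M e && ~~ aab e) -> hom_into H (fun e => M e || aab e) ->
  computes_bounded C (@f_hom n H) T -> (2 ^ j * 2 ^ j * #|B| <= 4 * (1296 * T ^ 2))%N.
Proof.
move=> F0 F1 comp.
have [alpha alpha_inj eA] := cube_of_set cA.
have alphaA u : alpha u \in A by rewrite eA imset_f.
(* Rivest-Vuillemin chain: G r keeps the AAB edges whose A-vertices lie in
   distinct blocks of size 2^r.  At the critical r, cut each block of size
   2^(r+1) into halves, of unions A' and A'': removing the box A'A''B from G r
   leaves a subset of G r.+1. *)
pose agree (r : nat) (u w : cube) := [forall i : 'I_j, (r <= i) ==> (u i == w i)].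
pose spread r e := [forall u, forall w,
  [&& alpha u \in e, alpha w \in e & u != w] ==> ~~ agree r u w].
pose G r e := if aab e then spread r e else M e.
(* [agree 0] is equality, so [G 0] keeps all AAB edges; [agree j] always holds, so [G j] keeps
   none. *)
have G0 : hom_into H (G 0).
  apply: hom_into_sub F1 => e _; rewrite /G; case: ifP => [_ _|_]; last by rewrite orbF.
  apply/forallP=> u; apply/forallP=> w; apply/implyP=> /and3P[_ _].
  by apply: contraNN => /forallP uw; apply/eqP/ffunP=> i; apply/eqP; have := uw i.
have Gj : ~~ hom_into H (G j).
  apply: contraNN F0; apply: hom_into_sub => e _; rewrite /G.
  case: ifP => [/andP[/eqP eA2 _] sp|_ ->//]; exfalso.
  have /card_gt1P[x [y [/setIP[xe xA] /setIP[ye yA] xy]]] : 1 < #|e :&: A| by rewrite eA2.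
  move: xA yA; rewrite eA => /imsetP[u _ xu] /imsetP[w _ yw].
  have := implyP (forallP (forallP sp u) w); rewrite -xu -yw xe ye.
  rewrite (contraNneq _ xy) => [/(_ isT)/negP|uw]; last by rewrite xu yw uw.
  by apply; apply/forallP=> i; rewrite leqNgt ltn_ord.
have exG : exists r, ~~ hom_into H (G r) by exists j.
case: (ex_minnP exG) => [[|r]]; first by rewrite G0.
move=> NGr1 minr; have lt_rj : r < j by apply: minr.
have Gr : hom_into H (G r).
  by apply: contraT => /minr; rewrite ltnn.
pose r0 := Ordinal lt_rj.
pose half b := [set alpha u | u in [pred u : cube | u r0 == b]].
have halfP b : exists s, toggles (half b) s /\
    {in s, forall tau, exists2 i, i != r0 &
       forall u, tau (alpha u) = if u r0 == b then alpha (flip i u) else alpha u}.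
  apply: (cube_toggles alpha_inj (Q := [pred u : cube | u r0 == b]) (K := [pred i | i != r0])).
    by move=> i u /= ne; rewrite ffunE (eq_sym r0) (negPf ne) addbF.
  by move=> u w /= /eqP uE /eqP wE i /negPn/eqP->; rewrite uE.
have [s0 [t0 s0E]] := halfP false; have [s1 [t1 s1E]] := halfP true.
have half_sub b : half b \subset A.
  by apply/subsetP=> v /imsetP[u _ ->].
have mem_half b u : (alpha u \in half b) = (u r0 == b).
  by apply/imsetP/idP => [[w wb /alpha_inj->]|ub]; last by exists u.
have d01 : [disjoint half false & half true].
  rewrite -setI_eq0; apply/eqP/setP=> v; rewrite !inE; apply/negbTE/andP.
  by case=> /imsetP[u uf ->]; rewrite mem_half => /eqP ut; rewrite inE ut in uf.
have dB b : [disjoint half b & B].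
  by apply: disjointWl dAB; apply: half_sub.
have A_half : A = half false :|: half true.
  apply/setP=> v; rewrite inE; apply/idP/orP => [|[]]; try by apply: subsetP (half_sub _) _.
  by rewrite eA => /imsetP[u _ ->]; rewrite !mem_half; case: (u r0); [right|left].
have card_half : 2 * #|half false| = 2 ^ j /\ 2 * #|half true| = 2 ^ j.
  have eqc : #|half false| = #|half true|.
    rewrite !card_imset // -(card_imset _ (@flip_inj _ r0)); apply: eq_card => u.
    apply/imsetP/idP => [[w /eqP wf ->]|ut]; first by rewrite inE ffunE wf eqxx.
    exists (flip r0 u); rewrite ?flipK // inE ffunE eqxx.
    by move: ut; rewrite inE => /eqP->.
  have := cardsU (half false) (half true); rewrite -A_half cA.
  by move: d01; rewrite -setI_eq0 => /eqP->; rewrite cards0 subn0 eqc; lia.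
have G_stable_A b s : toggles (half b) s ->
    {in s, forall tau, exists2 i, i != r0 &
       forall u, tau (alpha u) = if u r0 == b then alpha (flip i u) else alpha u} ->
    forall tau e, tau \in s -> G r (tau @: e) = G r e.
  move=> [on K _ _] sE tau e ts; have [i ne_i tauE] := sE _ ts.
  have onA : perm_on A tau by apply: subset_trans (on _ ts) (half_sub b).
  have aabE : aab (tau @: e) = aab e.
    by rewrite /aab !card_stableI //; apply: (perm_on_stable onA); auto.
  rewrite /G aabE; case: ifP => _; last by rewrite M_stable; auto.
  (* [phi] is the action of the toggle on labels. It preserves coordinate [r0]: labels in the same
     half are moved alike, and labels in different halves disagree at [r0] before and after, so
     [agree r] is invariant. *)
  pose phi (u : cube) := if u r0 == b then flip i u else u.
  have phiE u : tau (alpha u) = alpha (phi u) by rewrite tauE /phi; case: ifP.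
  have phiK : involutive phi.
    by move=> u; apply: alpha_inj; rewrite -!phiE (K _ ts).
  have mem_tau u : (alpha u \in tau @: e) = (alpha (phi u) \in e).
    by rewrite -{1}[u]phiK -phiE mem_imset //; apply: perm_inj.
  have phi_r0 u : phi u r0 = u r0.
    by rewrite /phi; case: ifP => // _; rewrite ffunE (eq_sym r0) (negPf ne_i) addbF.
  have agreeE u w : agree r (phi u) (phi w) = agree r u w.
    have [eq_r|neq_r] := eqVneq (u r0) (w r0).
      apply: eq_forallb => k; rewrite /phi eq_r; case: ifP => // _.
      by rewrite !ffunE (inj_eq (@addIb _)).
    transitivity false.
      by apply/forallP => /(_ r0)/implyP/(_ (leqnn r)); rewrite !phi_r0 (negPf neq_r).
    by apply/esym/forallP => /(_ r0)/implyP/(_ (leqnn r)); rewrite (negPf neq_r).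
  apply/forallP/forallP => sp u; apply/forallP=> w; apply/implyP=> /and3P[ue we uw].
    have := implyP (forallP (sp (phi u)) (phi w)).
    by rewrite !mem_tau !phiK ue we (inj_eq (inv_inj phiK)) uw agreeE; apply.
  have := implyP (forallP (sp (phi u)) (phi w)).
  by rewrite -!mem_tau ue we (inj_eq (inv_inj phiK)) uw agreeE; apply.
have G_stable_B tau e : tau \in sB -> G r (tau @: e) = G r e.
  case: tB => onB _ _ _ ts; have on := onB _ ts.
  have dBA : [disjoint B & A] by rewrite disjoint_sym.
  have aabE : aab (tau @: e) = aab e.
    by rewrite /aab !card_stableI //; apply: (perm_on_stable on); auto.
  rewrite /G aabE; case: ifP => _; last by rewrite M_stable; auto.
  have mem_tau u : (alpha u \in tau @: e) = (alpha u \in e).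
    rewrite -{1}[alpha u](out_perm on) ?(disjointFl dBA) //.
    by rewrite mem_imset //; apply: perm_inj.
  by apply: eq_forallb => u; apply: eq_forallb => w; rewrite !mem_tau.
have := @box_bound n H (half false) (half true) B s0 s1 sB (G r)
  d01 (dB _) (dB _) t0 t1 tB _ _ _ C T comp.
case: card_half => c0 c1 bound.
(* Each half contains half of the [2 ^ j] vertices of [A], hence the factor 4. *)
suff : #|half false| * #|half true| * #|B| <= 1296 * T ^ 2.
  by rewrite -{1}c0 -c1 => le_box; apply: leq_trans (leq_mul (leqnn 4) le_box); clear; lia.
apply: bound.
- move=> tau e; rewrite !mem_cat => /or3P[] ts _ _.
  + exact: (G_stable_A _ _ t0 s0E).
  + exact: (G_stable_A _ _ t1 s1E).
  exact: G_stable_B.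
- by apply: hom_into_sub Gr => e _ ->.
(* An AAB edge of [G r] lost in [G r.+1] has two A-vertices whose labels agree above [r] and
   therefore differ at [r0]: one lies in each half, so the edge belongs to the box. *)
apply: contraNN NGr1; apply: hom_into_sub => e _ /andP[]; rewrite /G.
case: ifP => // /andP[/eqP eA2 eB1] sp; apply: contraNT => /forallPn[u /forallPn[w]].
rewrite negb_imply negbK => /andP[/and3P[ue we uw] ag].
have := implyP (forallP (forallP sp u) w); rewrite ue we uw => /(_ isT) nag.
have neq_r : u r0 != w r0.
  apply: contraNneq nag => eq_r; apply/forallP=> i; apply/implyP.
  rewrite leq_eqVlt => /orP[/eqP ri|lt_ri]; last exact: (implyP (forallP ag i)).
  by rewrite (_ : i = r0) ?eq_r //; apply: val_inj.
have in_half b : exists x, x \in e :&: half b.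
  have [ub|] := eqVneq (u r0) b; first by exists (alpha u); rewrite inE ue mem_half ub eqxx.
  move=> ub; exists (alpha w); rewrite inE we mem_half.
  by move: neq_r ub; case: (u r0); case: (w r0); case: b.
have pos b : 0 < #|e :&: half b|.
  by apply/card_gt0P; have [x xe] := in_half b; exists x.
have := cardsU (e :&: half false) (e :&: half true); rewrite -setIUr -A_half eA2.
rewrite setIACA setIid; move: (d01); rewrite -setI_eq0 => /eqP->; rewrite setI0 cards0 subn0.
move: (pos false) (pos true); rewrite /box (eqP eB1) eqxx andbT.
move: #|_ :&: half false| #|_ :&: half true| => a b; clear.
by case: a b => [|[|a]] [|[|b]] // _ _; rewrite ?addnS ?addn0.
Qed.
End PairStep.

(** * Blow-up of a critical edge *)

Section Blowup.
Variables (n : nat) (H : hypergraph n).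
Local Notation V := 'I_n.
Implicit Types (e : {set V}).

(** [rho] collapses the three sets to the vertices of the critical edge, and [P] pulls back the
    other edges of [E]. With the box empty, [rho] maps the target into [E] without that edge; with
    the box full, [psi] embeds [E]. *)
Lemma edge_blowup (E : {set {set V}}) (p q r : V) (A1 A2 A3 : {set V})
    (s1 s2 s3 : seq {perm V}) (rho psi : V -> V)
    (C : numClosedFieldType) (T : nat) :
  hom_into H (fun e => e \in E) ->
  ~~ hom_into H (fun e => e \in E :\ [set p; q; r]) ->
  [disjoint A1 & A2] -> [disjoint A1 & A3] -> [disjoint A2 & A3] ->
  toggles A1 s1 -> toggles A2 s2 -> toggles A3 s3 ->
  {in A1, forall v, rho v = p} -> {in A2, forall v, rho v = q} ->
  {in A3, forall v, rho v = r} ->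
  psi p \in A1 -> psi q \in A2 -> psi r \in A3 ->
  (forall e, e \in E -> {in e, cancel psi rho}) ->
  computes_bounded C (@f_hom n H) T ->
  #|A1| * #|A2| * #|A3| <= 1296 * T ^ 2.
Proof.
move=> E1 E0 d12 d13 d23 t1 t2 t3 r1 r2 r3 pp pq pr psiK.
pose P e := (#|rho @: e| == 3) && (rho @: e \in E :\ [set p; q; r]).
apply: (@box_bound n H A1 A2 A3 s1 s2 s3 P) => //.
- move=> tau e ts _ _; have rho_tau v : rho (tau v) = rho v.
    case: (toggle_cases t1 t2 t3 ts) => -[_ on];
      [have [vA|vA] := boolP (v \in A1) | have [vA|vA] := boolP (v \in A2)
      |have [vA|vA] := boolP (v \in A3)]; try (by rewrite (out_perm on));
      by [rewrite !r1 ?(perm_closed _ on) | rewrite !r2 ?(perm_closed _ on)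
         | rewrite !r3 ?(perm_closed _ on)].
  by rewrite /P -imset_comp (eq_imset _ rho_tau).
- apply: hom_into_map E1 => e e3 eE.
  have psi3 : #|psi @: e| = 3 by rewrite card_in_imset //; apply: can_in_inj (psiK e eE).
  split; first exact: psi3.
  have [e_pqr|ne_pqr] := eqVneq e [set p; q; r].
    apply/orP; right; apply/boxP => //; exists (psi p), (psi q), (psi r).
    by split=> //; rewrite e_pqr !imsetU !imset_set1.
  rewrite /P -imset_comp (_ : _ @: e = e) ?e3 ?eqxx ?in_setD1 ?ne_pqr ?eE //.
  by rewrite -[RHS]imset_id; apply: eq_in_imset; apply: psiK.
apply: contraNN E0; apply: hom_into_map => e e3 /andP[/andP[/eqP rho3 rhoE] _].
by split; [exact: rho3 | exact: rhoE].
Qed.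

(** In an inclusion-minimal set of triples of [U] into which [H] maps, every edge is critical, and
    there is one because [H] has an edge. *)
Lemma critical_edge (U : {set V}) :
  H != set0 -> hom_into H (fun e => e \subset U) ->
  exists (E : {set {set V}}) (p q r : V),
  [/\ hom_into H (fun e => e \in E), ~~ hom_into H (fun e => e \in E :\ [set p; q; r]),
      forall e, e \in E -> e \subset U, [set p; q; r] \in E
    & [/\ p != q, p != r & q != r]].
Proof.
move=> /set0Pn[e0 e0H] HU.
have [E minE] : {E | minset (fun X => hom_into H (fun e => e \in X)) E
    & E \subset [set e : {set V} | (#|e| == 3) && (e \subset U)]}.
  by apply: minset_exists; apply: hom_into_sub HU => e e3 eU; rewrite inE e3 eU.
move/subsetP=> EU; have [HE minHE] := minsetP minE.
have [e eE] : exists e, e \in E.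
  apply/set0Pn; apply: contraTneq HE => ->; apply/existsP=> -[h /forall_inP hH].
  by have /existsP[g] := hH _ e0H; rewrite inE ffunE inE.
have /EU := eE; rewrite inE => /andP[e3 _].
have [p [q [r [ep npq npr nqr]]]] : exists p q r : V,
    [/\ e = [set p; q; r], p != q, p != r & q != r].
  have /card_gt0P[p pe] : 0 < #|e| by rewrite (eqP e3).
  have /cards2P[q [r [nqr eqr]]] : #|e :\ p| == 2 by move: e3; rewrite (cardsD1 p) pe.
  have /setD1P[qp _] : q \in e :\ p by rewrite eqr !inE eqxx.
  have /setD1P[rp _] : r \in e :\ p by rewrite eqr !inE eqxx orbT.
  exists p, q, r; rewrite (eq_sym p q) (eq_sym p r); split=> //.
  by rewrite -(setD1K pe) eqr setUA.
exists E, p, q, r; split=> //; rewrite -?ep //.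
  apply/negP=> /minHE/(_ (subD1set _ _))/setP/(_ e).
  by rewrite !inE eqxx eE.
by move=> f /EU; rewrite inE => /andP[].
Qed.

Definition ivl (a b : nat) : {set V} := [set v : V | (a <= v) && (v < b)].

Lemma card_ivl a b : b <= n -> #|ivl a b| = b - a.
Proof.
move=> le_bn; have lt_n (i : 'I_(b - a)) : a + i < n.
  by have := ltn_ord i; lia.
rewrite -[RHS]card_ord -cardsT -(@card_imset _ _ (fun i => Ordinal (lt_n i))); last first.
  by move=> i k [] /eqP; rewrite eqn_add2l => /eqP/val_inj.
apply: eq_card => v; rewrite inE; apply/idP/imsetP => [/andP[av vb]|[i _ ->] /=].
  have lt_i : v - a < b - a by lia.
  by exists (Ordinal lt_i) => //; apply: val_inj; rewrite /= subnKC.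
by have := ltn_ord i; lia.
Qed.

Lemma ivl_disjoint a b a' b' : b <= a' -> [disjoint ivl a b & ivl a' b'].
Proof.
move=> le_ba; rewrite -setI_eq0; apply/eqP/setP=> v; rewrite !inE; lia.
Qed.

Lemma blowup_bound (j : nat) (C : numClosedFieldType) (T : nat) :
  H != set0 -> 2 ^ j <= n -> hom_into H (fun e => e \subset ivl (2 ^ j) n) ->
  computes_bounded C (@f_hom n H) T -> (2 ^ j) ^ 3 <= 64 * (1296 * T ^ 2).
Proof.
move=> H0 le_n HU comp.
have [E [p [q [r [E1 E0 EU pqrE [npq npr nqr]]]]]] := critical_edge H0 HU.
have t1 v : exists s, toggles [set v : V] s by apply: (@set_toggles _ 0); rewrite cards1.
(* for j < 2 there is no room to blow up, and one free edge suffices *)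
have [lt_j2|le2j] := ltnP j 2.
  have [s1 ts1] := t1 p; have [s2 ts2] := t1 q; have [s3 ts3] := t1 r.
  have := edge_blowup (rho := id) (psi := id) E1 E0 _ _ _ ts1 ts2 ts3.
  rewrite !cards1 => /(_ C T) bound.
  suff : 1 * 1 * 1 <= 1296 * T ^ 2.
    have : (2 ^ j) ^ 3 <= 2 ^ 3 by rewrite leq_exp2r // -[X in _ <= X]expn1 leq_exp2l.
    by move: ((2 ^ j) ^ 3) (1296 * T ^ 2); clear; lia.
  by apply: bound => //; rewrite ?set11 ?disjoints1 ?inE //; move=> v; rewrite inE => /eqP.
(* [set_toggles] asks for sizes that are powers of two, so each of the three sets takes a quarter of
   the spare vertices; this costs 64 = 4^3. *)
pose w := 2 ^ (j - 2).
have w4 : 4 * w = 2 ^ j by rewrite /w -(expnD 2 2) subnKC.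
have w_gt0 : 0 < w by rewrite expn_gt0.
have [le1 le2 le3] : [/\ 0 + w <= n, w + w <= n & w + w + w <= n].
  by move: le_n w_gt0; rewrite -w4; clear; split; lia.
have [lt0 lt1 lt2] : [/\ 0 < n, w < n & w + w < n].
  by move: le3 w_gt0; clear; split; lia.
have cI k : k + w <= n -> #|ivl k (k + w)| = w.
  by move=> le_k; rewrite card_ivl // addKn.
have tI k : k + w <= n -> exists s, toggles (ivl k (k + w)) s.
  by move=> le_k; apply: (@set_toggles _ (j - 2)); rewrite cI.
have [s1 ts1] := tI _ le1; have [s2 ts2] := tI _ le2; have [s3 ts3] := tI _ le3.
pose rho (v : V) := if v < w then p else if v < w + w then q
  else if v < w + w + w then r else v.
pose psi (v : V) := if v == p then Ordinal lt0 else if v == q then Ordinal lt1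
  else if v == r then Ordinal lt2 else v.
have := edge_blowup (rho := rho) (psi := psi) (C := C) (T := T) E1 E0 _ _ _ ts1
  ts2 ts3 _ _ _ _ _ _ _ comp.
rewrite !cI // => bound; suff : w * w * w <= 1296 * T ^ 2.
  by rewrite -w4 => /(leq_mul (leqnn 64)); congr (_ <= _); clear; lia.
apply: bound.
- by apply: ivl_disjoint.
- by apply: ivl_disjoint; rewrite add0n leq_addr.
- by apply: ivl_disjoint.
- by move=> v; rewrite inE /rho add0n => /andP[_ ->].
- by move=> v; rewrite inE /rho => /andP[wv ->]; rewrite ltnNge wv.
- move=> v; rewrite inE /rho => /andP[wv ->]; rewrite !ltnNge wv /=.
  by rewrite (leq_trans (leq_addr w w) wv).
- by rewrite /psi eqxx inE /= add0n.
- by rewrite /psi (eq_sym q) (negPf npq) eqxx inE /= leqnn -[X in X < _]addn0 ltn_add2l.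
- by rewrite /psi (eq_sym r p) (negPf npr) (eq_sym r q) (negPf nqr) eqxx inE /= leqnn -[X in X < _]addn0 ltn_add2l.
move=> e /EU/subsetP eU v /eU; rewrite inE => /andP[vU _]; rewrite /rho /psi.
(* The vertices of [E] lie beyond the three intervals, so [rho] fixes those that [psi] leaves in
   place. *)
have [le_wv le_2wv le_3wv] : [/\ w <= v, w + w <= v & w + w + w <= v].
  by move: vU; rewrite -w4; clear; split; lia.
have [->|_] := eqVneq v p; first by rewrite /= w_gt0.
have [->|_] := eqVneq v q.
  by rewrite /= ltnn -[X in X < _]addn0 ltn_add2l w_gt0.
have [->|_] := eqVneq v r.
  by rewrite /= ltnn ltnNge leq_addr /= -[X in X < _]addn0 ltn_add2l w_gt0.
by rewrite !ltnNge le_wv le_2wv le_3wv.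
Qed.
End Blowup.

(** * From the separated to the complete hypergraph *)

Section Split.
Variables (n : nat) (H : hypergraph n).
Local Notation V := 'I_n.
Implicit Types (e : {set V}).
Local Notation ivl := (@ivl n).

Lemma card_ivl_cat e a b c : a <= b -> b <= c ->
  #|e :&: ivl a c| = #|e :&: ivl a b| + #|e :&: ivl b c|.
Proof.
move=> le_ab le_bc.
have -> : ivl a c = ivl a b :|: ivl b c.
  apply/setP=> v; rewrite !inE; case: (ltnP v b) => [lt_vb|le_bv] /=.
    by rewrite ?andbT ?andbF ?orbF (leq_trans lt_vb) ?andbT.
  by rewrite (leq_trans le_ab le_bv) ?andbF.
rewrite setIUr cardsU setIACA setIid (_ : ivl a b :&: _ = set0) ?setI0 ?cards0 ?subn0 //.
by apply/eqP; rewrite setI_eq0; apply: ivl_disjoint.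
Qed.

Lemma card_ivl_all e a b : a <= b -> b <= n ->
  #|e| = #|e :&: ivl 0 a| + #|e :&: ivl a b| + #|e :&: ivl b n|.
Proof.
move=> le_ab le_bn; rewrite -!card_ivl_cat ?(leq_trans le_ab) //.
by apply: eq_card => v; rewrite !inE leq0n ltn_ord !andbT.
Qed.

Variables (j : nat) (C : numClosedFieldType) (T : nat).
Local Notation s := (2 ^ j).
Let A := ivl 0 s.
Let B := ivl s (s + s).
Hypothesis le3 : s + s + s <= n.
Hypothesis comp : computes_bounded C (@f_hom n H) T.

Let s_gt0 : 0 < s. Proof. by rewrite expn_gt0. Qed.
Let le2 : s + s <= n. Proof. by apply: leq_trans le3; rewrite leq_addr. Qed.
Let le1 : s <= n. Proof. by apply: leq_trans le2; rewrite leq_addr. Qed.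

Let separated e := ~~ ((0 < #|e :&: A|) && (0 < #|e :&: B|)).

(** The ABd edges enter one vertex [d] at a time, in increasing order; at [n - (s + s)] all are
    present. *)
Let window i e := separated e ||
  [&& #|e :&: A| == 1, #|e :&: B| == 1 & #|e :&: ivl (s + s) (s + s + i)| == 1].

Lemma cardA : #|A| = s. Proof. by rewrite card_ivl // subn0. Qed.
Lemma cardB : #|B| = s. Proof. by rewrite card_ivl // addKn. Qed.
Lemma disjAB : [disjoint A & B]. Proof. exact: ivl_disjoint. Qed.

(* Translation by s identifies A with B, whose pairs no separated edge joins. *)
Lemma separated_hom : hom_into H separated -> hom_into H (fun e => e \subset ivl s n).
Proof.
pose psi (v : V) : V := insubd v (if v < s then v + s else v).
have psiE v : psi v = (if v < s then v + s else v) :> nat.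
  rewrite val_insubd; case: (ltnP v s) => [lt_vs|_]; last by rewrite if_same.
  by rewrite (leq_trans _ le2) // ltn_add2r.
apply: (@hom_into_map _ _ psi) => e e3 sep.
have crossP (v w : V) : v \in e -> w \in e -> v < s -> s <= w -> psi v <> psi w.
  move=> ve we lt_vs le_sw /(congr1 val); rewrite /= !psiE lt_vs ltnNge le_sw /= => vw.
  case/negP: sep; apply/andP; split; apply/card_gt0P; [exists v | exists w].
    by rewrite !inE ve.
  by rewrite !inE we le_sw -vw ltn_add2r.
split.
  rewrite card_in_imset // => v w ve we eq_vw; apply/val_inj.
  case: (ltnP v s) (ltnP w s) => [lt_v|le_v] [lt_w|le_w].
  - by have := congr1 val eq_vw; rewrite /= !psiE lt_v lt_w => /addIn.
  - by case: (crossP v w).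
  - by case: (crossP w v).
  by have := congr1 val eq_vw; rewrite /= !psiE !ltnNge le_v le_w.
apply/subsetP=> _ /imsetP[v _ ->]; rewrite inE ltn_ord andbT psiE.
by case: ltnP => // _; rewrite leq_addl.
Qed.

Lemma window_bound : ~~ hom_into H separated -> hom_into H (window (n - (s + s))) ->
  s * s * s <= 1296 * T ^ 2.
Proof.
move=> N0 Hm; set m := n - (s + s) in Hm.
have exi : exists i, hom_into H (window i) by exists m.
case: (ex_minnP exi) => i Hi mini.
have le_im : i <= m by apply: mini.
have i_gt0 : 0 < i.
  rewrite lt0n; apply: contraNneq N0 => i0; apply: hom_into_sub Hi => e _.
  case/orP => // /and3P[_ _]; rewrite i0 (_ : ivl _ _ = set0) ?setI0 ?cards0 //.
  by apply/setP=> v; rewrite !inE addn0; case: (ltnP v) => // /leqNgt; rewrite andbF.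
(* [hom_into H (window i)] is monotone in i, so a jump at i can be spread over
   s consecutive values *)
pose i0 := i - s.
have lt_i0 : i0 < i by rewrite /i0 ltn_subrL s_gt0.
have le_i : i <= i0 + s by rewrite addnC -leq_subLR.
(* If [i < s] then [i0] is 0 by truncation, and [W] still fits because [n] is at least three times
   [s]. *)
have le_i0m : s + s + i0 + s <= n.
  by move: le_im le3 i_gt0; rewrite /m /i0; move: s => t; clear; lia.
pose W := ivl (s + s + i0) (s + s + i0 + s).
have cardW : #|W| = s by rewrite card_ivl // addKn.
have dAW : [disjoint A & W] by apply: ivl_disjoint; rewrite -addnA leq_addr.
have dBW : [disjoint B & W] by apply: ivl_disjoint; rewrite leq_addr.
have [sA tA] := set_toggles cardA; have [sB tB] := set_toggles cardB.
have [sW tW] := set_toggles cardW.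
rewrite -[X in X * _ * _]cardA -[X in _ * X * _]cardB -cardW.
pose Z := ivl (s + s) (s + s + i0).
apply: (@box_bound n H A B W sA sB sW (window i0) disjAB dAW dBW tA tB tW _ _ _ C T comp).
- move=> tau e ts _ _.
  have stable (X : {set V}) : tau \in sA ++ sB ++ sW ->
      (A = X \/ [disjoint A & X]) -> (B = X \/ [disjoint B & X]) ->
      (W = X \/ [disjoint W & X]) -> #|(tau @: e) :&: X| = #|e :&: X|.
    move=> _ aX bX wX; apply: card_stableI.
    by case: (toggle_cases tA tB tW ts) => -[_ on]; apply: (perm_on_stable on).
  have dAZ : [disjoint A & Z] by apply: ivl_disjoint; rewrite leq_addr.
  have dBZ : [disjoint B & Z] by apply: ivl_disjoint.
  have dWZ : [disjoint W & Z] by rewrite disjoint_sym; apply: ivl_disjoint.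
  have [dAB dBA] : [disjoint A & B] /\ [disjoint B & A].
    by rewrite [X in _ /\ is_true X]disjoint_sym; split; apply: disjAB.
  by rewrite /window /separated !stable //; do ?[by left | by right; rewrite // disjoint_sym].
(* The third vertex of an ABd edge of [window i] lies in [Z], giving an edge of [window i0], or in
   [W], giving a box edge. *)
- apply: hom_into_sub Hi => e e3; rewrite /window /box.
  case/orP=> [->//|/and3P[eA eB /eqP ei]]; rewrite eA eB /= -orbA; apply/orP; right.
  have : #|e :&: ivl (s + s) (s + s + i)| <= #|e :&: ivl (s + s) (s + s + i0 + s)|.
    apply/subset_leq_card/setIS/subsetP=> v; rewrite !inE => /andP[-> lt_v].
    by apply: leq_trans lt_v _; rewrite -!addnA !leq_add2l.
  have := card_ivl_all e (leq_addr s s) le2; rewrite -/A -/B e3 (eqP eA) (eqP eB) ei.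
  rewrite (@card_ivl_cat e (s + s) (s + s + i0 + s) n) //; last by rewrite -addnA leq_addr.
  rewrite (@card_ivl_cat e (s + s) (s + s + i0)) ?leq_addr // -/W.
  move: #|_ :&: ivl (s + s) _| #|_ :&: W| #|_ :&: ivl _ n| => x y z; clear.
  by case: x y z => [|[|x]] [|[|y]] [|z] //=; lia.
apply: contraTN lt_i0 => Hw; rewrite -leqNgt; apply: mini.
by apply: hom_into_sub Hw => e _ /andP[].
Qed.

(** The separated edges are rejected and the complete hypergraph is accepted, so one of the three
    enlargements, by the ABd, then AAB, then ABB edges, changes the answer. The constant 64 is that
    of the blow-up case. *)
Lemma split_bound : ~~ hom_into H (fun e => e \subset ivl s n) ->
  s ^ 3 <= 64 * (1296 * T ^ 2).
Proof.
move=> NU.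
suff [le_s|le_s] : s * s * s <= 1296 * T ^ 2 \/ s * s * s <= 4 * (1296 * T ^ 2).
- by rewrite !expnS expn0 muln1 mulnA; apply: leq_trans le_s _; clear; lia.
- by rewrite !expnS expn0 muln1 mulnA; apply: leq_trans le_s _; clear; lia.
have N0 : ~~ hom_into H separated by apply: contraNN NU; apply: separated_hom.
have [Hm|Nm] := boolP (hom_into H (window (n - (s + s)))).
  by left; apply: window_bound.
right.
have [sA tA] := set_toggles cardA; have [sB tB] := set_toggles cardB.
have disjBA : [disjoint B & A] by rewrite disjoint_sym disjAB.
(* [M] leaves out the ABB edges, so its triples other than AAB are edges of the full window. *)
pose M e := ~~ ((#|e :&: B| == 2) && (#|e :&: A| == 1)).
have Mst tau e : perm_on A tau \/ perm_on B tau -> M (tau @: e) = M e.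
  have [dAB dBA] := (disjAB, disjBA).
  by case=> on; rewrite /M !card_stableI //; apply: (perm_on_stable on); auto.
have N1 : ~~ hom_into H (fun e => M e && ~~ ((#|e :&: A| == 2) && (#|e :&: B| == 1))).
  apply: contraNN Nm; apply: hom_into_sub => e e3; rewrite /M /window /separated.
  rewrite subnKC //; have := card_ivl_all e (leq_addr s s) le2; rewrite -/A -/B e3.
  move: #|_ :&: A| #|_ :&: B| #|_ :&: ivl _ n| => x y z; clear.
  by case: x y z => [|[|[|x]]] [|[|[|y]]] [|[|z]] //=; lia.
have [H1|N2] := boolP (hom_into H (fun e => M e || ((#|e :&: A| == 2) && (#|e :&: B| == 1)))).
  rewrite -[X in _ * X <= _]cardB.
  exact: (pair_step disjAB cardA tB Mst N1 H1 comp).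
(* Only the ABB edges are still missing: the same step applies with [A] and [B] exchanged, and the
   identity maps [H] into the complete hypergraph. *)
rewrite -[X in _ * X <= _]cardA.
apply: (@pair_step n H B A j sA xpredT disjBA cardB tA (fun _ _ _ => erefl) C T _ _ comp).
  by apply: contraNN N2; apply: hom_into_sub => e _ /= Me; rewrite /M Me.
apply/existsP; exists [ffun v => v]; apply/forall_inP=> e eH.
apply/existsP; exists e; rewrite inE ffunE /=; apply/eqP.
by rewrite -[LHS]imset_id; apply: eq_imset => v; rewrite ffunE.
Qed.

End Split.

Local Open Scope ring_scope.

(* Q(f_[H]) >= c n^{3/2}, stated as: every bounded-error T-query algorithm
   has c^2 n^3 <= T^2 (equivalently T >= c n^{3/2}). *)
Theorem theorem6 :
  exists c : rat, 0 < c /\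
    forall (n : nat), (3 <= n)%N ->
    forall H : hypergraph n, H != set0 ->
    forall (C : numClosedFieldType) (T : nat),
      computes_bounded C (@f_hom n H) T ->
      c ^+ 2 * (n%:R) ^+ 3 <= (T%:R) ^+ 2.
Proof.
(* [c ^+ 2] is the inverse of [72 ^ 4], which exceeds [216 * 64 * 1296]: 216 = 6^3 comes from
   [n <= 6 * 2 ^ j], the rest from the bound on the cube of [2 ^ j]. *)
exists ((1 / 72%:R) ^+ 2); split.
  by apply: exprn_gt0; rewrite div1r invr_gt0 ltr0n.
move=> n le3n H H0 C T comp.
(* The largest power of two of which three copies fit into [n]. *)
pose j := trunc_log 2 (n %/ 3).
have /andP[le_s lt_s] : (2 ^ j <= n %/ 3 < 2 ^ j.+1)%N.
  by apply: trunc_log_bounds; rewrite // divn_gt0.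
have {}le_s : (2 ^ j + 2 ^ j + 2 ^ j <= n)%N.
  by move: le_s; rewrite leq_divRL //; clear; lia.
have {}lt_s : (n <= 6 * 2 ^ j)%N.
  by move: lt_s; rewrite ltn_divLR // expnS; clear; lia.
have box_le : ((2 ^ j) ^ 3 <= 64 * (1296 * T ^ 2))%N.
  have [HU|NU] := boolP (hom_into H (fun e => e \subset ivl n (2 ^ j) n)).
    by apply: blowup_bound HU comp => //; apply: leq_trans le_s; rewrite leq_addl.
  exact: split_bound le_s comp NU.
have cube_le : (n ^ 3 <= 72 * (72 * (72 * (72 * T ^ 2))))%N.
  have : (n ^ 3 <= (6 * 2 ^ j) ^ 3)%N by rewrite leq_exp2r.
  by rewrite expnMn -[(6 ^ 3)%N]/216%N => /leq_trans; apply; move: box_le; clear; lia.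
have : (n ^ 3)%:R <= (72 * (72 * (72 * (72 * T ^ 2))))%:R :> rat by rewrite ler_nat.
by rewrite natrX !(natrM _ 72) natrX; move: (n%:R ^+ 3) (T%:R ^+ 2) => x y; lra.
Qed.
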